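(* Let $k\ge 2$ and let $v\in S_k$. Then the right-insertion system $(\mathsf{X}_v,s,m,A_v,\Phi_v)$, with root $x_\varnothing$ the state of the empty permutation, is a right-visible growth system. In particular, there exist $0<\theta<1$ and $0<\kappa<1$ such that for all $z\in\mathbb{C}$ with $|z|\le 1$ the transfer operator $T_{v,z}$ is bounded and quasi-compact on $\mathcal{B}_{\theta,\kappa}$. Moreover, combined with the identity expressing $|\mathrm{Av}_n(v)|$ as the total mass $\sum_{y\in\mathsf{X}_v}\bigl((T_{v,1}^\ast)^n\delta_{x_\varnothing}\bigr)(y)$ and with the Marcus--Tardos theorem, this yields that there exists $R_v>0$ such that $$F_v(z):=\sum_{n\ge 0}|\mathrm{Av}_n(v)|\,z^n$$ is analytic for $|z|<R_v$; equivalently, $\limsup_{n\to\infty}|\mathrm{Av}_n(v)|^{1/n}$ is finite.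
   Context: Permutations are written in one-line notation; $S_n$ is the set of permutations of $\{1,\dots,n\}$ ($S_0$ contains only the empty permutation $\varnothing$); $\sim$ denotes order-isomorphism of sequences. A permutation $\pi$ contains $v\in S_k$ if some subsequence of $\pi$ of length $k$ is order-isomorphic to $v$, and avoids $v$ otherwise; $\mathrm{Av}_n(v)$ is the set of $\pi\in S_n$ avoiding $v$, and $\mathrm{Av}(v)=\bigcup_n\mathrm{Av}_n(v)$. Right insertion: for $\pi\in S_n$ and $r\in\{1,\dots,n+1\}$, $\mathrm{ins}(\pi,r)\in S_{n+1}$ is obtained by increasing by $1$ every value of $\pi$ that is $\ge r$ and appending the value $r$ at position $n+1$. Frontier: for $\pi\in S_n$ avoiding $v$, a $(k-1)$-partial occurrence of $v$ in $\pi$ is a tuple $i_1<\dots<i_{k-1}$ of positions with $(\pi_{i_1},\dots,\pi_{i_{k-1}})\sim(v_1,\dots,v_{k-1})$. Its forbidden rank set is $$J_\pi(i_1,\dots,i_{k-1})=\{r\in\{1,\dots,n+1\}:\ \pi'=\mathrm{ins}(\pi,r)\text{ satisfies }(\pi'_{i_1},\dots,\pi'_{i_{k-1}},\pi'_{n+1})\sim(v_1,\dots,v_k)\}.$$ The frontier $\mathcal{F}_v(\pi)$ is the set of all $(k-1)$-partial occurrences with nonempty forbidden rank set, and $\mathrm{Forb}_v(\pi)=\bigcup_{p\in\mathcal{F}_v(\pi)}J_\pi(p)$. State space: $\mathsf{X}_v$ is the set of pairs $x=(\pi,\mathcal{F}_v(\pi))$ with $\pi\in\mathrm{Av}(v)$;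 $m(x)=|\mathcal{F}_v(\pi)|$, $s(x)=|\pi|$ (the length of $\pi$), $A_v(x)=\{1,\dots,s(x)+1\}\setminus\mathrm{Forb}_v(\pi)$, and for $r\in A_v(x)$, $\Phi_v(x,r)=(\pi',\mathcal{F}_v(\pi'))$ with $\pi'=\mathrm{ins}(\pi,r)$. A right-visible growth system consists of a countable set $X$ with a root $x_\varnothing\in X$, functions $s,m:X\to\mathbb{N}$, a finite set $A(x)$ for each $x\in X$, and a map $\Phi:\{(x,r):x\in X,r\in A(x)\}\to X$ such that: (RV1) for each $L\in\mathbb{N}$ only finitely many $x$ have $s(x)\le L$; (RV2) $s(\Phi(x,r))=s(x)+1$; (RV3) $m(\Phi(x,r))\ge m(x)$; (RV4) there are constants $C_0,C_1\ge0$ with $|A(x)|\le C_0+C_1s(x)$ for all $x$. For $0<\theta,\kappa<1$, $\mathcal{B}_{\theta,\kappa}$ is the Banach space of $f:\mathsf{X}_v\to\mathbb{C}$ with $\|f\|_{\theta,\kappa}=\sup_x\theta^{-m(x)}\kappa^{-s(x)^2}|f(x)|<\infty$, and $(T_{v,z}f)(x)=\sum_{r\in A_v(x)}z\,f(\Phi_v(x,r))$. Quasi-compact means that the essential spectral radius is $<1$. The operator $T_{v,1}^\ast$ acts on $\{\mu:\mathsf{X}_v\to\mathbb{C}:\sum_x|\mu(x)|\theta^{m(x)}\kappa^{s(x)^2}<\infty\}$ by $(T_{v,1}^\ast\mu)(y)=\sum_{x,\ r\in A_v(x),\ \Phi_v(x,r)=y}\mu(x)$, and $\delta_{x_\varnothing}$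 is the function equal to $1$ at $x_\varnothing$ and $0$ elsewhere. Marcus--Tardos theorem (known): for every permutation $v$ there is $C_v<\infty$ with $|\mathrm{Av}_n(v)|\le C_v^n$ for all $n\ge0$. *)

(* Defs.v *)
From HB Require Import structures.
From mathcomp Require Import all_boot all_order all_algebra all_fingroup.
From mathcomp Require Import all_classical all_reals all_analysis.
From mathcomp Require Import complex.

Set Implicit Arguments.
Unset Strict Implicit.
Unset Printing Implicit Defensive.

Import Order.TTheory GRing.Theory Num.Theory numFieldNormedType.Exports.

Local Open Scope classical_set_scope.
Local Open Scope ring_scope.

(* Permutations, patterns, right insertion.  Positions and values are counted
   from 0: ['S_n] acts on {0, ..., n-1} and ranks range over ['I_n.+1]. *)

Section Patterns.
Local Open Scope nat_scope.

Definition order_iso (s t : seq nat) : bool :=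
  (size s == size t) &&
  [forall i : 'I_(size s), forall j : 'I_(size s),
     (nth 0 s i < nth 0 s j) == (nth 0 t i < nth 0 t j)].

Definition oneline (n : nat) (p : 'S_n) : seq nat :=
  [seq val (p i) | i <- enum 'I_n].

Definition increasing (n : nat) (q : seq 'I_n) : bool :=
  sorted (fun i j : 'I_n => i < j) q.

Definition subvalues (n : nat) (p : 'S_n) (q : seq 'I_n) : seq nat :=
  [seq val (p i) | i <- q].

Definition contains (k : nat) (v : 'S_k) (n : nat) (p : 'S_n) : bool :=
  [exists q : k.-tuple 'I_n,
     increasing q && order_iso (subvalues p q) (oneline v)].

Definition avoids (k : nat) (v : 'S_k) (n : nat) (p : 'S_n) : bool :=
  ~~ contains v p.

Definition Av (k : nat) (v : 'S_k) (n : nat) : {set 'S_n} :=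
  [set p | avoids v p]%SET.

(* [lift_perm ord_max r p] sends the new last position to [r] and every old
   position [i] to [p i], increased by 1 when [r <= p i]. *)
Definition ins (n : nat) (p : 'S_n) (r : 'I_n.+1) : 'S_n.+1 :=
  lift_perm ord_max r p.

Definition partial_occ (k : nat) (v : 'S_k) (n : nat) (p : 'S_n)
    (q : k.-1.-tuple 'I_n) : bool :=
  increasing q && order_iso (subvalues p q) (take k.-1 (oneline v)).

(* [lift ord_max] is the inclusion of the positions of [p] into those of
   [ins p r], and [ord_max] is the new position. *)
Definition forbidden_ranks (k : nat) (v : 'S_k) (n : nat) (p : 'S_n)
    (q : seq 'I_n) : {set 'I_n.+1} :=
  [set r | order_iso
             (subvalues (ins p r) (rcons [seq lift ord_max i | i <- q] ord_max))
             (oneline v)]%SET.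

Definition frontier (k : nat) (v : 'S_k) (n : nat) (p : 'S_n) :
    {set k.-1.-tuple 'I_n} :=
  [set q : k.-1.-tuple 'I_n |
     partial_occ v p q && (forbidden_ranks v p q != finset.set0)]%SET.

Definition Forb (k : nat) (v : 'S_k) (n : nat) (p : 'S_n) : {set 'I_n.+1} :=
  (\bigcup_(q in frontier v p) forbidden_ranks v p q)%SET.

Lemma order_isoP (s t : seq nat) :
  reflect (size s = size t /\ forall i j, i < size s -> j < size s ->
             (nth 0 s i < nth 0 s j) = (nth 0 t i < nth 0 t j))
          (order_iso s t).
Proof.
apply: (iffP andP) => [[/eqP sst /forallP h]|[sst h]].
  split=> // i j si sj.
  by move/forallP: (h (Ordinal si)) => /(_ (Ordinal sj)) /eqP.
split; first exact/eqP.
by apply/forallP => i; apply/forallP => j; apply/eqP/h.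
Qed.

Lemma order_iso_take (m : nat) (s t : seq nat) :
  order_iso s t -> order_iso (take m s) (take m t).
Proof.
move=> /order_isoP[sst h]; apply/order_isoP; split.
  by rewrite !size_take sst.
move=> i j; rewrite !size_take_min !leq_min => /andP[im si] /andP[jm sj].
by rewrite !nth_take// h.
Qed.

Lemma increasing_unlift (n : nat) (t : seq 'I_n.+1) : increasing t ->
  exists2 q : seq 'I_n, increasing q &
    t = [seq lift ord_max i | i <- q] \/
    t = rcons [seq lift ord_max i | i <- q] ord_max.
Proof.
have lowP (s : seq 'I_n.+1) : {in s, forall x, x != ord_max} ->
    exists q : seq 'I_n, s = [seq lift ord_max i | i <- q].
  elim: s => [|x s IH] h; first by exists [::].
  have [|q ->] := IH; first by move=> y ys; apply: h; rewrite inE ys orbT.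
  have : ord_max != x by rewrite eq_sym h ?mem_head.
  by case/unlift_some => y -> _; exists (y :: q).
have incE (q : seq 'I_n) :
    increasing [seq lift ord_max i | i <- q] = increasing q.
  rewrite /increasing sorted_map; congr sorted.
  by apply/funext => i; apply/funext => j; rewrite /= /bump (ltn_geF (ltn_ord i)) (ltn_geF (ltn_ord j)).
case/lastP: t => [|s x] incs; first by exists [::]; [|left].
have tr : transitive (fun i j : 'I_n.+1 => i < j).
  by move=> a b c; exact: ltn_trans.
have : pairwise (fun i j : 'I_n.+1 => i < j) (rcons s x).
  by rewrite -sorted_pairwise.
rewrite pairwise_rcons => /andP[/allP sx ps].
have [|q sq] := lowP s.
  move=> y /sx yx; apply/eqP => yE; move: yx; rewrite yE /=.
  by rewrite ltnNge -ltnS ltn_ord.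
have incq : increasing q by rewrite -incE -sq /increasing sorted_pairwise.
have [xE|xN] := eqVneq x ord_max.
  by exists q => //; right; rewrite xE sq.
move: xN; rewrite eq_sym => /unlift_some[y xy _].
exists (rcons q y); last by left; rewrite map_rcons -sq xy.
by rewrite -incE map_rcons -sq -xy.
Qed.

Lemma ins_lift (n : nat) (p : 'S_n) (r : 'I_n.+1) (i : 'I_n) :
  ins p r (lift ord_max i) = lift r (p i).
Proof. exact: lift_perm_lift. Qed.

Lemma order_iso_ins (n : nat) (p : 'S_n) (r : 'I_n.+1) (q : seq 'I_n)
    (t : seq nat) :
  order_iso (subvalues (ins p r) [seq lift ord_max i | i <- q]) t =
  order_iso (subvalues p q) t.
Proof.
rewrite /subvalues -map_comp /order_iso !size_map; congr andb.
apply: eq_forallb => i; apply: eq_forallb => j; congr (_ == _).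
case: q i j => [|x0 q] i j; first by case: i.
rewrite !(nth_map x0) ?ltn_ord//= !ins_lift /=.
set a := nat_of_ord (p _); set b := nat_of_ord (p _).
by rewrite !ltnNge leq_bump2.
Qed.

Lemma avoids_ins (k : nat) (v : 'S_k) (n : nat) (p : 'S_n) (r : 'I_n.+1) :
  avoids v p -> r \notin Forb v p -> avoids v (ins p r).
Proof.
move=> av; apply: contra => /existsP[t /andP[inct ot]].
have st : size t = k := size_tuple t.
have [q incq [tE|tE]] := increasing_unlift inct; rewrite tE in ot st.
  rewrite order_iso_ins in ot; rewrite size_map in st.
  have sq : size q == k by rewrite st.
  case/negP: av; apply/existsP; exists (Tuple sq).
  by rewrite incq.
rewrite size_rcons size_map in st.
have sq : size q == k.-1 by rewrite -st.
have rJ : r \in forbidden_ranks v p q by rewrite inE.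
apply/bigcupP; exists (Tuple sq) => //.
rewrite inE; apply/andP; split; last by apply/set0Pn; exists r.
apply/andP; split=> //.
move/(order_iso_take k.-1): ot; rewrite /subvalues map_rcons -cats1.
rewrite take_size_cat ?size_map ?(eqP sq)// -map_comp => ot.
by rewrite -(order_iso_ins p r) /subvalues -map_comp.
Qed.

Lemma avoids_empty (k : nat) (v : 'S_k) (p : 'S_0) : 0 < k -> avoids v p.
Proof.
case: k v => // k v _; apply/negP => /existsP[t _].
by case: (thead t).
Qed.

End Patterns.

Record growth_system := GrowthSystem {
  gs_state : choiceType;
  gs_root : gs_state;
  gs_size : gs_state -> nat;
  gs_mult : gs_state -> nat;
  gs_act : gs_state -> finType;
  gs_next : forall x : gs_state, gs_act x -> gs_state }.

Definition right_visible (R : realType) (G : growth_system) : Prop :=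
  [/\ countable [set: gs_state G],
      forall L : nat, finite_set [set x : gs_state G | (gs_size x <= L)%N],
      forall (x : gs_state G) (r : gs_act x),
        gs_size (gs_next r) = (gs_size x).+1,
      forall (x : gs_state G) (r : gs_act x),
        (gs_mult x <= gs_mult (gs_next r))%N
    & exists C0 C1 : R, [/\ 0 <= C0, 0 <= C1 &
        forall x : gs_state G,
          #|{: gs_act x}|%:R <= C0 + C1 * (gs_size x)%:R] ].

(* A state is a triple (n, p, F) where p is a permutation of length n that
   avoids v and F is its frontier. *)
Section InsertionSystem.
Variables (k : nat) (v : 'S_k).

Definition prestate : Type := {n : nat & 'S_n * {set k.-1.-tuple 'I_n}}%type.

Definition is_state (x : prestate) : bool :=
  avoids v (tagged x).1 && ((tagged x).2 == frontier v (tagged x).1).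

Definition state : Type := {x : prestate | is_state x}.

HB.instance Definition _ := Choice.on state.

Definition st_size (x : state) : nat := tag (val x).
Definition st_perm (x : state) : 'S_(st_size x) := (tagged (val x)).1.
Definition st_front (x : state) : {set k.-1.-tuple 'I_(st_size x)} :=
  (tagged (val x)).2.
Definition st_mult (x : state) : nat := #|st_front x|.

Lemma st_avoids (x : state) : avoids v (st_perm x).
Proof. by have /andP[] := valP x. Qed.

Lemma mk_state_subproof (n : nat) (p : 'S_n) : avoids v p ->
  is_state (Tagged (fun n => 'S_n * {set k.-1.-tuple 'I_n})%type
                   (p, frontier v p)).
Proof. by move=> av; rewrite /is_state av eqxx. Qed.

Definition mk_state (n : nat) (p : 'S_n) (av : avoids v p) : state :=
  exist (fun x : prestate => is_state x) _ (mk_state_subproof av).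

Definition admissible (x : state) : {set 'I_(st_size x).+1} :=
  (~: Forb v (st_perm x))%SET.

Definition st_act (x : state) : finType := {r | r \in admissible x}.

Lemma st_act_notin (x : state) (r : st_act x) :
  val r \notin Forb v (st_perm x).
Proof. by have := valP r; rewrite inE. Qed.

Definition st_next (x : state) (r : st_act x) : state :=
  mk_state (avoids_ins (st_avoids x) (st_act_notin r)).

Definition st_root (hk : (1 < k)%N) : state :=
  mk_state (avoids_empty v (1%g : 'S_0) (ltnW hk)).

Definition insertion_system (hk : (1 < k)%N) : growth_system :=
  GrowthSystem (st_root hk) st_size st_mult st_next.

End InsertionSystem.

Section Transfer.
Variables (R : realType) (G : growth_system).

Definition transfer (z : R[i]) (f : gs_state G -> R[i]) (x : gs_state G) :
    R[i] :=
  \sum_(r : gs_act x) z * f (gs_next r).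

(* [\sum_(_ \in _)] is the sum of a finitely supported family.  In a
   right-visible system every state has finitely many predecessors, since they
   all have the same size, so the index set below is finite. *)
Definition transfer_dual (mu : gs_state G -> R[i]) (y : gs_state G) : R[i] :=
  \sum_(e \in [set e : {x : gs_state G & gs_act x} |
                 gs_next (tagged e) = y]) mu (tag e).

Definition dirac_root (x : gs_state G) : R[i] := (x == gs_root G)%:R.

End Transfer.

(* Weighted supremum-norm space of complex functions; the norm takes values in
   [R[i]], its field of scalars, so the real supremum is embedded by [%:C]. *)
Section WeightedSpace.
Variables (R : realType) (G : growth_system) (theta kappa : {posnum R}).

Definition wabs (f : gs_state G -> R[i]) (x : gs_state G) : R :=
  theta%:num ^- gs_mult x * kappa%:num ^- (gs_size x ^ 2) *
  Normc.normc (f x).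

Definition wbounded : {pred gs_state G -> R[i]^o} :=
  fun f => `[< has_ubound (range (wabs f)) >].

Record wspace := WSpace {
  wfun :> gs_state G -> R[i]^o;
  wfun_bounded : wfun \in wbounded }.

HB.instance Definition _ := [isSub for wfun].
HB.instance Definition _ := [Choice of wspace by <:].

Definition wnorm (f : wspace) : R := sup (range (wabs f)).

Lemma wabs_ge0 f x : 0 <= wabs f x.
Proof.
rewrite /wabs !mulr_ge0 ?invr_ge0 ?exprn_ge0//.
by case: (f x) => a b; exact: sqrtr_ge0.
Qed.

Lemma wabsD f g x : wabs (f + g) x <= wabs f x + wabs g x.
Proof.
rewrite /wabs -mulrDr ler_wpM2l ?mulr_ge0 ?invr_ge0 ?exprn_ge0//.
exact: le_normcD.
Qed.

Lemma wabsZ (c : R[i]) (f : gs_state G -> R[i]^o) x :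
  wabs (c *: f) x = Normc.normc c * wabs f x.
Proof. by rewrite /wabs mulrCA -Normc.normcM. Qed.

Lemma wbounded_submod : GRing.submod_closed wbounded.
Proof.
split=> [|c f g /asboolP[M hM] /asboolP[N hN]].
  apply/asboolP; exists 0 => _ [x _ <-].
  by rewrite /wabs Normc.normc0 mulr0.
apply/asboolP; exists (Normc.normc c * M + N) => _ [x _ <-].
rewrite (le_trans (wabsD _ _ _))// wabsZ lerD//; last by apply: hN; exists x.
apply: ler_wpM2l; last by apply: hM; exists x.
by case: (c) => a b; exact: sqrtr_ge0.
Qed.

HB.instance Definition _ :=
  GRing.isSubmodClosed.Build R[i] (gs_state G -> R[i]^o) wbounded
    (GRing.submod_closed_semi wbounded_submod).
HB.instance Definition _ := [SubChoice_isSubLmodule of wspace by <:].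

Lemma wnorm_ub (f : wspace) x : wabs f x <= wnorm f.
Proof.
apply: ub_le_sup; last by exists x.
by have /asboolP := wfun_bounded f.
Qed.

Lemma wnorm_le (f : wspace) M : (forall x, wabs f x <= M) -> wnorm f <= M.
Proof.
move=> h; apply: ge_sup; first by exists (wabs f (gs_root G)); exists (gs_root G).
by move=> _ [x _ <-].
Qed.

Lemma wnormD (f g : wspace) :
  (wnorm (f + g))%:C%C <= (wnorm f)%:C%C + (wnorm g)%:C%C.
Proof.
rewrite -rmorphD lecR; apply: wnorm_le => x.
by rewrite (le_trans (wabsD _ _ _))// lerD// wnorm_ub.
Qed.

Lemma wnormZ (c : R[i]) (f : wspace) :
  (wnorm (c *: f))%:C%C = `|c| * (wnorm f)%:C%C.
Proof.
have cE : `|c| = (Normc.normc c)%:C%C by [].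
have c0 : 0 <= Normc.normc c by case: (c) => a b; exact: sqrtr_ge0.
rewrite cE -rmorphM; congr (_%:C%C); apply/eqP; rewrite eq_le; apply/andP; split.
  by apply: wnorm_le => x; rewrite wabsZ ler_wpM2l// wnorm_ub.
have [->|cN0] := eqVneq (Normc.normc c) 0.
  by rewrite mul0r (le_trans (wabs_ge0 (c *: f) (gs_root G)))// wnorm_ub.
rewrite mulrC -ler_pdivlMr ?lt_neqAle 1?eq_sym ?cN0//.
apply: wnorm_le => x; rewrite ler_pdivlMr ?lt_neqAle 1?eq_sym ?cN0//.
by rewrite mulrC -wabsZ (wnorm_ub (c *: f)).
Qed.

Lemma wnorm0_eq0 (f : wspace) : (wnorm f)%:C%C = 0 :> R[i] -> f = 0.
Proof.
move=> [f0]; apply/val_inj/funext => x.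
have : wabs f x == 0 by rewrite eq_le wabs_ge0 -f0 wnorm_ub.
rewrite /wabs mulf_eq0 => /orP[|/eqP/Normc.eq0_normc//].
by rewrite mulf_eq0 !invr_eq0 !expf_eq0 !gt_eqF// !andbF.
Qed.

HB.instance Definition _ :=
  @Lmodule_isNormed.Build R[i] wspace (fun f => (wnorm f)%:C%C)
    wnormD wnormZ wnorm0_eq0.

End WeightedSpace.

Section QuasiCompact.
Variables (R : realType) (E : normedModType R[i]).

Definition bounded_operator (T : E -> E) : Prop :=
  exists M : R[i], forall f : E, `|T f| <= M * `|f|.

(* Kernel of finite dimension, closed range of finite codimension. *)
Definition fredholm (T : E -> E) : Prop :=
  [/\ exists (d : nat) (b : 'I_d -> E), forall f : E, T f = 0 ->
        exists c : 'I_d -> R[i], f = \sum_(i < d) c i *: b i,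
      closed (range T)
    & exists (d : nat) (b : 'I_d -> E), forall g : E,
        exists (f : E) (c : 'I_d -> R[i]),
          g = T f + \sum_(i < d) c i *: b i].

Definition essential_spectrum (T : E -> E) : set R[i] :=
  [set l | ~ fredholm (fun f => T f - l *: f)].

(* [Normc.normc] is the modulus as an element of [R]. *)
Definition essential_spectral_radius (T : E -> E) : \bar R :=
  ereal_sup [set (Normc.normc l)%:E | l in essential_spectrum T].

Definition quasi_compact (T : E -> E) : Prop :=
  (essential_spectral_radius T < 1)%E.

End QuasiCompact.

Section PowerSeries.
Variable K : numFieldType.

Definition power_series (a : nat -> K) (z : K) : nat -> K :=
  series (fun n => a n * z ^+ n).

Definition analytic_at (f : K -> K) (z0 : K) : Prop :=
  exists a : nat -> K, \forall z \near z0,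
    power_series a (z - z0) n @[n --> \oo] --> f z.

End PowerSeries.

Definition Av_coef (R : realType) (k : nat) (v : 'S_k) (n : nat) : R[i] :=
  #|Av v n|%:R.

Definition Av_gf (R : realType) (k : nat) (v : 'S_k) (z : R[i]) : R[i] :=
  limn (@power_series R[i] (Av_coef R v) z).

(* Main.v *)
(* The weight kappa ^ (s(x)^2) decays so fast that T_z has norm at most
   sup_s (C_0 + C_1 s) kappa ^ (2 s + 1), which is at most 1/2 once kappa is
   small.  Hence T_z - l is invertible (Neumann series) whenever |l| > 1/2, so
   the essential spectral radius is at most 1/2 without any compactness
   argument.  A permutation of length n + 1 is ins(p, r) for exactly one pair
   (p, r), so (T^* )^n maps the Dirac mass at the root to the indicator function
   of the states of length n.

   Exponential growth of |Av_n(v)| is proved for 0-1 matrices.  If A avoids v,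
   so does the matrix recording which s x s blocks of A are nonzero; by the
   pigeonhole principle each column of blocks has boundedly many blocks meeting
   at least k columns, and dually for rows, which gives |A| = O(n) by recursion
   (Marcus and Tardos).  Applying this to 2 x 2 blocks bounds the number of
   avoiding matrices by induction (Klazar).  The generating function is then
   dominated by a geometric series, and re-expanding it around a point of a
   small disc shows that it is analytic there. *)

From HB Require Import structures.
Require Import Defs.
From mathcomp Require Import all_boot all_order all_algebra all_fingroup.
From mathcomp Require Import zify.

Set Implicit Arguments.
Unset Strict Implicit.
Unset Printing Implicit Defensive.

(** * The Marcus-Tardos theorem *)

Section PatternMatrices.
Local Open Scope nat_scope.

Definition mx_occ k (v : 'S_k) m n (A : {set 'I_m * 'I_n})
    (r : 'I_k -> 'I_m) (c : 'I_k -> 'I_n) : Prop :=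
  [/\ {homo r : i j / i < j}, {homo c : i j / i < j}
    & forall i, (r i, c (v i)) \in A].

Definition mx_contains k (v : 'S_k) m n (A : {set 'I_m * 'I_n}) : bool :=
  [exists r : {ffun 'I_k -> 'I_m}, exists c : {ffun 'I_k -> 'I_n},
    [&& [forall i : 'I_k, forall j : 'I_k, (i < j) ==> (r i < r j)],
        [forall i : 'I_k, forall j : 'I_k, (i < j) ==> (c i < c j)]
      & [forall i, (r i, c (v i)) \in A]]].

Lemma mx_containsP k (v : 'S_k) m n (A : {set 'I_m * 'I_n}) :
  reflect (exists r c, mx_occ v A r c) (mx_contains v A).
Proof.
apply: (iffP existsP) => [[r /existsP[c /and3P[hr hc hA]]]|[r [c [hr hc hA]]]].
  exists r, c; split=> [i j ij|i j ij|i]; last exact: (forallP hA).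
  - by move/forallP/(_ i)/forallP/(_ j)/implyP: hr; apply.
  - by move/forallP/(_ i)/forallP/(_ j)/implyP: hc; apply.
exists (finfun r); apply/existsP; exists (finfun c); apply/and3P; split.
- apply/forallP => i; apply/forallP => j; rewrite !ffunE.
  by apply/implyP; apply: hr.
- apply/forallP => i; apply/forallP => j; rewrite !ffunE.
  by apply/implyP; apply: hc.
- by apply/forallP => i; rewrite !ffunE.
Qed.

(** Choose a preimage in [A] for each one of the occurrence. A weakly monotone map reflects strict
    inequalities, so the preimages are ordered like their images. Column [j] of the pattern is read
    off its one in row [v^-1 j]. *)
Lemma mx_contains_image k (v : 'S_k) m n m' n' (A : {set 'I_m * 'I_n})
    (f : 'I_m -> 'I_m') (g : 'I_n -> 'I_n') :
  {homo f : x y / (x <= y)%N} -> {homo g : x y / (x <= y)%N} ->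
  mx_contains v [set (f a.1, g a.2) | a in A] -> mx_contains v A.
Proof.
move=> hf hg /mx_containsP[r [c [hr hc hA]]]; apply/mx_containsP.
have /fin_all_exists [a ha] i :
    exists a, a \in A /\ (r i, c (v i)) = (f a.1, g a.2).
  by have /imsetP[a aA e] := hA i; exists a.
exists (fun i => (a i).1), (fun j => (a ((v^-1)%g j)).2); split=> [i j|i j|i].
- have [_ [ei _]] := ha i; have [_ [ej _]] := ha j.
  move=> /hr; rewrite ei ej; apply: contraLR; rewrite -!leqNgt; exact: hf.
- have [_ [_ ei]] := ha (v^-1 i)%g; have [_ [_ ej]] := ha (v^-1 j)%g.
  move=> /hc; rewrite -{1}(permKV v i) -{1}(permKV v j) ei ej.
  apply: contraLR; rewrite -!leqNgt; exact: hg.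
- by rewrite permK -surjective_pairing; case: (ha i).
Qed.

Definition tr_set m n (A : {set 'I_m * 'I_n}) : {set 'I_n * 'I_m} :=
  [set (a.2, a.1) | a in A].

(** Through this, bounds on block columns also yield bounds on block rows. *)
Lemma mx_contains_tr k (v : 'S_k) m n (A : {set 'I_m * 'I_n}) :
  mx_contains (v^-1)%g (tr_set A) -> mx_contains v A.
Proof.
move=> /mx_containsP[r [c [hr hc hA]]]; apply/mx_containsP.
exists c, r; split=> // i; have /imsetP[a aA [-> e]] := hA (v i).
by rewrite permK in e; rewrite e -surjective_pairing.
Qed.

Lemma increasing_selection n (S : {set 'I_n}) k : k <= #|S| ->
  exists2 h : 'I_k -> 'I_n, {homo h : i j / i < j} & forall i, h i \in S.
Proof.
move=> kS; exists (fun i => enum_val (widen_ord kS i)); last first.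
  by move=> i; apply: enum_valP.
move=> i j ij.
have x0 : 'I_n by exact: (enum_val (widen_ord kS i)).
rewrite !(enum_val_nth x0) /=.
have lt_trans : transitive (fun i j : 'I_n => i < j).
  by move=> b a d; exact: ltn_trans.
have so : sorted (fun i j : 'I_n => i < j) (enum S).
  rewrite /enum_mem sorted_filter// -enumT -(@sorted_map _ _ val ltn) val_enum_ord.
  exact: iota_ltn_sorted.
have sz (l : 'I_k) : l < size (enum S) by rewrite -cardE (leq_trans _ kS).
by apply: (sorted_ltn_nth lt_trans x0 so); rewrite ?inE.
Qed.

(** * Contraction of a matrix to its blocks *)

Lemma block_subproof s n (i : 'I_n) : i %/ s < (n %/ s).+1.
Proof. by rewrite ltnS leq_div2r // ltnW. Qed.

(** For [s > 0] the last of the [(n %/ s).+1] blocks has only [n %% s] indices, possibly none. *)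
Definition block s n (i : 'I_n) : 'I_(n %/ s).+1 :=
  Ordinal (block_subproof s i).

Lemma block_homo s n : {homo @block s n : i j / i <= j}.
Proof. by move=> i j ij; apply: leq_div2r. Qed.

Lemma card_block s n (b : 'I_(n %/ s).+1) : 0 < s ->
  #|[set i | block s i == b]| <= s.
Proof.
move=> s0; pose h (i : 'I_n) : 'I_s := Ordinal (ltn_pmod i s0).
rewrite -[leqRHS]card_ord -(@card_in_imset _ _ h) ?max_card//.
move=> i j; rewrite !inE => /eqP ib /eqP jb [hij]; apply/val_inj => /=.
rewrite (divn_eq i s) (divn_eq j s) hij.
by have /(congr1 val) /= -> : block s i = block s j by rewrite ib jb.
Qed.

Definition blocks s n (A : {set 'I_n * 'I_n}) :=
  [set (block s a.1, block s a.2) | a in A].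

Lemma blocks_contains k (v : 'S_k) s n (A : {set 'I_n * 'I_n}) :
  mx_contains v (blocks s A) -> mx_contains v A.
Proof. by apply: mx_contains_image; apply: block_homo. Qed.

(** Applied to [tr_set A] with the block indices swapped, this gives the rows occupied by a
    block. *)
Definition block_cols s n (A : {set 'I_n * 'I_n}) b1 b2 : {set 'I_n} :=
  [set a.2 | a in [set a in A | (block s a.1 == b1) && (block s a.2 == b2)]].
Arguments block_cols s {n} A b1 b2.

(** At most [2 ^ s] sets of columns are available inside block column [b2]. If more than [k] wide
    blocks shared one set [S], then [k] of them, one for each row of the pattern, and [k] columns of
    [S] would give an occurrence of [v]. *)
Lemma card_wide_blocks k (v : 'S_k) s n (A : {set 'I_n * 'I_n}) b2 :
  0 < s -> ~~ mx_contains v A ->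
  #|[set b1 | k <= #|block_cols s A b1 b2|]| <= 2 ^ s * k.
Proof.
move=> s0 avA; set W := [set b1 | _].
pose U := powerset [set i : 'I_n | block s i == b2].
have colsU b1 : block_cols s A b1 b2 \in U.
  rewrite inE; apply/subsetP => x /imsetP[a].
  by rewrite !inE => /and3P[_ _ ab] ->.
have -> : #|W| = \sum_(S in U) #|[set b1 in W | block_cols s A b1 b2 == S]|.
  rewrite -sum1_card (partition_big (fun b1 => block_cols s A b1 b2) (mem U)) //=.
  by apply: eq_bigr => S _; rewrite -sum1_card; apply: eq_bigl => b; rewrite !inE.
apply: (@leq_trans (\sum_(S in U) k)); last first.
  rewrite sum_nat_const leq_mul2r card_powerset leq_exp2l // card_block //.
  by rewrite orbT.
apply: leq_sum => S _; rewrite leqNgt; apply: contra avA => kS.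
have [r hr rS] := increasing_selection (ltnW kS).
have [|c hc cS] := @increasing_selection _ S k.
  have /card_gt0P[b1] : 0 < #|[set b1 in W | block_cols s A b1 b2 == S]|.
    exact: leq_ltn_trans kS.
  by rewrite !inE => /andP[h /eqP <-].
(* Every column of [S] is occupied in every chosen block, so block row [r i] has a one in column
   [c (v i)]. *)
have /fin_all_exists [a ha] i :
    exists a, [/\ a \in A, block s a.1 = r i & a.2 = c (v i)].
  have := rS i; rewrite !inE => /andP[_ /eqP e].
  have := cS (v i); rewrite -e => /imsetP[a].
  by rewrite inE => /and3P[aA /eqP ar _] ->; exists a.
apply/mx_containsP; exists (fun i => (a i).1), c; split => // [i j|i].
  have [_ ei _] := ha i; have [_ ej _] := ha j.
  move=> /hr; rewrite -ei -ej; apply: contraLR; rewrite -!leqNgt.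
  exact: block_homo.
by have [aA _ <-] := ha i; rewrite -surjective_pairing.
Qed.

Lemma card_wide_blocks_all k (v : 'S_k) s n (A : {set 'I_n * 'I_n}) :
  0 < s -> ~~ mx_contains v A ->
  #|[set b | k <= #|block_cols s A b.1 b.2|]| <= (n %/ s).+1 * (2 ^ s * k).
Proof.
move=> s0 avA; set W := [set b | _].
have -> : #|W| = \sum_(b2 : 'I_(n %/ s).+1)
    #|[set b1 | k <= #|block_cols s A b1 b2|]|.
  rewrite -sum1_card (partition_big (fun b => b.2) predT) //=.
  apply: eq_bigr => b2 _; rewrite -sum1_card.
  rewrite (reindex_onto (fun b1 => (b1, b2)) (fun b => b.1)) /=; last first.
    by move=> [b1 b] /andP[_ /eqP <-].
  by apply: eq_bigl => b; rewrite !inE /= !eqxx !andbT.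
rewrite -[X in X * _]card_ord -sum_nat_const; apply: leq_sum => b2 _.
exact: card_wide_blocks avA.
Qed.

(** The ones of a block lie in the product of its occupied rows and its occupied columns. *)
Lemma card_block_ones s n (A : {set 'I_n * 'I_n}) b :
  #|[set a in A | (block s a.1, block s a.2) == b]| <=
  #|block_cols s (tr_set A) b.2 b.1| * #|block_cols s A b.1 b.2|.
Proof.
rewrite -cardsX; apply/subset_leq_card/subsetP => -[x y].
rewrite !inE /= => /andP[aA ab]; case: b ab => b1 b2 /andP[/= h1 h2].
apply/andP; split; apply/imsetP.
  exists (y, x) => //; rewrite !inE /= h1 h2 !andbT.
  by apply/imsetP; exists (x, y).
by exists (x, y) => //; rewrite !inE /= aA h1 h2.
Qed.

Lemma card_block_cols s n (A : {set 'I_n * 'I_n}) b1 b2 : 0 < s ->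
  #|block_cols s A b1 b2| <= s.
Proof.
move=> s0; apply: leq_trans (card_block b2 s0).
apply/subset_leq_card/subsetP => x /imsetP[a].
by rewrite !inE => /and3P[_ _ ab] ->.
Qed.

(** A block with fewer than [k] occupied rows and fewer than [k] occupied columns has at most
    [k ^ 2] ones. Any other block has at most [s ^ 2], and there are at most [2 ^ s * k] wide ones
    per block column and as many tall ones per block row. *)
Lemma card_blocks_le k (v : 'S_k) s n (A : {set 'I_n * 'I_n}) :
  0 < s -> ~~ mx_contains v A ->
  #|A| <= k ^ 2 * #|blocks s A| + 2 * s ^ 2 * (2 ^ s * k) * (n %/ s).+1.
Proof.
move=> s0 avA.
pose wide (b : 'I_(n %/ s).+1 * 'I_(n %/ s).+1) := k <= #|block_cols s A b.1 b.2|.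
pose tall (b : 'I_(n %/ s).+1 * 'I_(n %/ s).+1) :=
  k <= #|block_cols s (tr_set A) b.2 b.1|.
have -> : #|A| = \sum_(b in blocks s A)
    #|[set a in A | (block s a.1, block s a.2) == b]|.
  rewrite -sum1_card (partition_big (fun a => (block s a.1, block s a.2))
    (mem (blocks s A))) /=; last by move=> a aA; apply: imset_f.
  by apply: eq_bigr => b _; rewrite -sum1_card; apply: eq_bigl => a; rewrite !inE.
apply: (@leq_trans (\sum_(b in blocks s A)
    (k ^ 2 + (wide b * s ^ 2 + tall b * s ^ 2)))).
  apply: leq_sum => b _; apply: leq_trans (card_block_ones A b) _.
  have c1 := card_block_cols (tr_set A) b.2 b.1 s0.
  have c2 := card_block_cols A b.1 b.2 s0.
  have c12 := leq_mul c1 c2; rewrite /wide /tall -!mulnn.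
  case: (leqP k #|block_cols s A b.1 b.2|) => /= h1.
    by rewrite mul1n addnCA (leq_trans c12) ?leq_addr.
  case: (leqP k #|block_cols s (tr_set A) b.2 b.1|) => /= h2.
    by rewrite mul1n addnA (leq_trans c12) ?leq_addl.
  by rewrite addn0 leq_mul // ltnW.
rewrite big_split /= sum_nat_const mulnC leq_add2l.
have wt : \sum_b wide b <= (n %/ s).+1 * (2 ^ s * k).
  apply: leq_trans (card_wide_blocks_all s0 avA).
  rewrite -sum1_card [leqRHS]big_mkcond /=; apply: leq_sum => b _.
  by rewrite inE /wide; case: (k <= #|_|).
have tt : \sum_b tall b <= (n %/ s).+1 * (2 ^ s * k).
  have avA' : ~~ mx_contains (v^-1)%g (tr_set A).
    by apply: contra avA; apply: mx_contains_tr.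
  apply: leq_trans (card_wide_blocks_all s0 avA').
  rewrite -sum1_card.
  (* [tall] speaks of the transposed matrix, so the two block indices are exchanged. *)
  rewrite (reindex_inj (inv_inj (_ : involutive (fun b => (b.2, b.1)))))/=; last by case.
  rewrite [leqRHS]big_mkcond /=; apply: leq_sum => -[b c] _.
  by rewrite inE /tall /=; case: (k <= #|_|).
apply: (@leq_trans (\sum_b (wide b * s ^ 2 + tall b * s ^ 2))).
  by rewrite [leqLHS]big_mkcond /=; apply: leq_sum => b _; case: ifP.
rewrite big_split /= -!big_distrl /= -mulnDl.
apply: leq_trans (leq_mul (leq_add wt tt) (leqnn _)) _.
by move: (2 ^ s * k) (s ^ 2) (n %/ s).+1 => x y z; lia.
Qed.

(* With blocks of side [2 k^2], the recursive term [k^2 * |blocks|] is about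
   half of the bound to be proved. *)
Lemma furedi_hajnal k (v : 'S_k) : 0 < k ->
  exists c, forall n (A : {set 'I_n * 'I_n}), ~~ mx_contains v A ->
    #|A| <= c * n.
Proof.
move=> k0; pose s := 2 * k ^ 2; pose D := 2 * s ^ 2 * (2 ^ s * k).
have s0 : 0 < s by rewrite muln_gt0 expn_gt0 k0.
(* The term [8 * k ^ 2] settles [n < 8 * k ^ 2], where [|A| <= n ^ 2]. For larger [n],
   [k ^ 2 * (n %/ s).+1 <= 5 n / 8], which leaves room for the additive [D * (n %/ s).+1]. *)
exists (4 * D + 8 * k ^ 2); elim/ltn_ind => n IH A avA.
have [nk|nk] := ltnP n (8 * k ^ 2).
  apply: (@leq_trans (n * n)); last by rewrite leq_mul2r; apply/orP; right; lia.
  by apply: leq_trans (max_card _) _; rewrite card_prod card_ord.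
have k21 : 0 < k ^ 2 by rewrite expn_gt0 k0.
have ns : (n %/ s) * s <= n by exact: leq_trunc_div.
have lt_sn : (n %/ s).+1 < n by rewrite /s in ns *; nia.
have := IH _ lt_sn (blocks s A) (contra (@blocks_contains _ _ _ _ _) avA).
have := card_blocks_le s0 avA; rewrite -/D {IH avA}.
move: #|A| #|blocks s A| => a b.
move: (n %/ s) ns lt_sn => q; rewrite /s; move: D (k ^ 2) k21 nk => D' K *.
have : K * b <= K * ((4 * D' + 8 * K) * q.+1) by rewrite leq_mul2l; apply/orP; right.
nia.
Qed.

(** * Counting the avoiding matrices *)

Definition avoiders k (v : 'S_k) n : {set {set 'I_n * 'I_n}} :=
  [set A | ~~ mx_contains v A].

(* A matrix is a subset of the at most [4 |B|] cells covered by its set [B] of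
   nonzero 2 x 2 blocks. *)
Lemma card_avoiders_half k (v : 'S_k) c n :
  (forall n (A : {set 'I_n * 'I_n}), ~~ mx_contains v A -> #|A| <= c * n) ->
  #|avoiders v n| <= #|avoiders v (n %/ 2).+1| * 16 ^ (c * (n %/ 2).+1).
Proof.
move=> hc; rewrite -sum1_card.
rewrite (partition_big (@blocks 2 n) (mem (avoiders v (n %/ 2).+1))) /=; last first.
  by move=> A; rewrite !inE; apply: contra; apply: blocks_contains.
rewrite -sum_nat_const; apply: leq_sum => B; rewrite inE => avB.
pose cells := [set a : 'I_n * 'I_n | (block 2 a.1, block 2 a.2) \in B].
apply: (@leq_trans #|powerset cells|).
  rewrite sum1_card; apply/subset_leq_card/subsetP => A.
  rewrite !inE => /andP[_ /eqP AB]; apply/subsetP => a aA.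
  by rewrite inE -AB; apply: imset_f.
have le_cells : #|cells| <= 4 * #|B|.
  rewrite -sum1_card (partition_big (fun a => (block 2 a.1, block 2 a.2)) (mem B)) /=.
    rewrite mulnC -sum_nat_const; apply: leq_sum => -[b1 b2] _.
    have := leq_mul (card_block b1 (isT : 0 < 2)) (card_block b2 (isT : 0 < 2)).
    apply: leq_trans; rewrite sum1_card -cardsX.
    by apply/subset_leq_card/subsetP => -[x y]; rewrite !inE => /andP[_].
  by move=> a; rewrite inE.
(* Each of the at most [c * (n %/ 2).+1] nonzero blocks has 4 cells, hence the factor [2 ^ 4]. *)
rewrite card_powerset -[16]/(2 ^ 4) -expnM leq_exp2l //.
by rewrite (leq_trans le_cells) // leq_mul2l hc.
Qed.

Lemma card_avoiders k (v : 'S_k) : 0 < k ->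
  exists K, forall n, #|avoiders v n| <= K ^ n.
Proof.
move=> /(furedi_hajnal v)[c0 hc0].
have {c0 hc0} [c c1 hc] : exists2 c, 0 < c & forall n (A : {set 'I_n * 'I_n}),
    ~~ mx_contains v A -> #|A| <= c * n.
  exists c0.+1 => // n A avA; rewrite (leq_trans (hc0 n A avA)) //.
  by rewrite leq_mul2r leqnSn orbT.
(* With [h = (n %/ 2).+1] the recursion gives the exponent [3 c h + c h], and [4 h <= 3 n] once
   [n >= 4]. For [n < 4] the number [2 ^ (n ^ 2)] of all matrices is small enough because
   [c >= 1]. *)
exists (16 ^ (3 * c)); elim/ltn_ind => n IH; rewrite -expnM.
have [n4|n4] := ltnP n 4.
  apply: leq_trans (max_card _) _.
  rewrite -cardsT -powersetT card_powerset cardsT card_prod card_ord.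
  rewrite -[16]/(2 ^ 4) -expnM leq_exp2l //; nia.
have hn : (n %/ 2).+1 < n by lia.
apply: leq_trans (card_avoiders_half n hc) _.
apply: leq_trans (leq_mul (IH _ hn) (leqnn _)) _.
by rewrite -expnM -expnD leq_exp2l //; nia.
Qed.

End PatternMatrices.

(* Imported only here: [all_classical] hides many lemmas on finite sets. *)
From mathcomp Require Import all_classical all_reals all_analysis.
From mathcomp Require Import complex.
From mathcomp Require Import ring lra.

Import Order.TTheory GRing.Theory Num.Theory numFieldNormedType.Exports.

Local Open Scope classical_set_scope.
Local Open Scope ring_scope.

(** * Permutations as matrices, and the effect of right insertion on occurrences and frontiers *)

Section Insertion.
Local Open Scope nat_scope.

(** In a graph the selected row determines the column, [c (v i) = p (r i)]. Strict monotonicity of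
    [c] is then the order-isomorphism with [v]. *)
Lemma mx_contains_graph k (v : 'S_k) n (p : 'S_n) :
  mx_contains v [set (i, p i) | i in [set: 'I_n]]%SET -> contains v p.
Proof.
move=> /mx_containsP[r [c [hr hc hA]]].
have cE i : c (v i) = p (r i) by have /imsetP[j _ [-> ->]] := hA i.
have [e [se so ve]] : exists e : seq 'I_k, [/\ size e = k,
    sorted (fun i j : 'I_k => i < j) e & oneline v = [seq val (v i) | i <- e]].
  exists (enum 'I_k); rewrite size_enum_ord; split=> //.
  by rewrite -(@sorted_map _ _ val ltn) val_enum_ord iota_ltn_sorted.
have sz : size [seq r i | i <- e] == k by rewrite size_map se.
apply/existsP; exists (Tuple sz); apply/andP; split => /=.
  by rewrite /increasing sorted_map; apply: sub_sorted so => i j; apply: hr.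
apply/order_isoP; rewrite ve /subvalues /= -map_comp !size_map; split=> // i j.
rewrite se => ik jk; pose x0 : 'I_k := Ordinal ik.
rewrite !(nth_map x0) ?se //= -!cE.
set a := v _; set b := v _.
case: (ltngtP a b) => [/hc->//|/hc/ltnW|/val_inj->]; last by rewrite ltnn.
by rewrite leqNgt => /negbTE.
Qed.

Lemma card_Av k (v : 'S_k) : 0 < k -> exists K, forall n, #|Av v n| <= K ^ n.
Proof.
move=> /(card_avoiders v)[K hK]; exists K => n; apply: leq_trans (hK n).
pose graph (p : 'S_n) := [set (i, p i) | i in [set: 'I_n]]%SET.
rewrite -(@card_imset _ _ graph); last first.
  move=> p q pq; apply/permP => i.
  have : (i, p i) \in graph q by rewrite -pq; apply: imset_f.
  by case/imsetP => j _ [-> ->].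
apply/subset_leq_card/fintype.subsetP => _ /imsetP[p pA ->].
have /negP av : avoids v p by rewrite /Av finset.in_set in pA.
rewrite /avoiders finset.in_set; apply/negP => h.
by apply: av; apply: (@mx_contains_graph _ v _ p h).
Qed.

Lemma increasing_lift n (q : seq 'I_n) :
  increasing [seq lift ord_max i | i <- q] = increasing q.
Proof.
rewrite /increasing sorted_map; congr sorted.
apply/funext => i; apply/funext => j.
by rewrite /= /bump (ltn_geF (ltn_ord i)) (ltn_geF (ltn_ord j)).
Qed.

Lemma increasing_rcons_lift n (q : seq 'I_n) :
  increasing (rcons [seq lift ord_max i | i <- q] ord_max) = increasing q.
Proof.
have tr m : transitive (fun i j : 'I_m => i < j).
  by move=> a b c; exact: ltn_trans.
rewrite -[RHS]increasing_lift /increasing !(sorted_pairwise (tr _)).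
rewrite pairwise_rcons; apply/andb_idl => _; apply/allP => _ /mapP[i _ ->].
by rewrite /= /bump (ltn_geF (ltn_ord i)) ltn_ord.
Qed.

Lemma contains_ins k (v : 'S_k) n (p : 'S_n) r :
  contains v p -> contains v (ins p r).
Proof.
move=> /existsP[t /andP[inct ot]]; apply/existsP; exists (map_tuple (lift ord_max) t).
by rewrite /= increasing_lift inct order_iso_ins.
Qed.

(** Converse of [avoids_ins]: a forbidden rank completes its partial occurrence to one of length
    [k]. *)
Lemma contains_ins_Forb k (v : 'S_k) n (p : 'S_n) r : 0 < k ->
  r \in Forb v p -> contains v (ins p r).
Proof.
move=> k0 /bigcupP[q]; rewrite !inE => /andP[/andP[incq _] _] oq.
have sq : size (rcons [seq lift ord_max i | i <- q] (@ord_max n)) == k.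
  by rewrite size_rcons size_map size_tuple prednK.
by apply/existsP; exists (Tuple sq); rewrite /= increasing_rcons_lift incq.
Qed.

Lemma order_iso_bump h s t : order_iso (map (bump h) s) t = order_iso s t.
Proof.
rewrite /order_iso size_map; congr andb.
apply: eq_forallb => i; apply: eq_forallb => j; congr (_ == _).
by rewrite !(nth_map 0) ?ltn_ord // !ltnNge leq_bump2.
Qed.

(** Insertion keeps the relative order of the values at [q], so a rank completing [q] has a
    counterpart between the same values of the enlarged permutation. *)
Lemma forbidden_ranks_ins k (v : 'S_k) n (p : 'S_n) r (q : seq 'I_n) :
  forbidden_ranks v p q != finset.set0 ->
  forbidden_ranks v (ins p r) [seq lift ord_max i | i <- q] != finset.set0.
Proof.
have values m (u : 'S_m) x (l : seq 'I_m) :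
    subvalues (ins u x) (rcons [seq lift ord_max i | i <- l] ord_max) =
    rcons [seq bump x j | j <- subvalues u l] x.
  rewrite /subvalues map_rcons /ins lift_perm_id -!map_comp; congr rcons.
  by apply: eq_map => i /=; rewrite lift_perm_lift.
move=> /set0Pn[r' r'q]; apply/set0Pn.
(* Inserting [r'] and then re-inserting [r] amounts to applying [bump h] to the
   values of [ins p r']. *)
pose h := bump r' r.
have h_lt : bump h r' < n.+2.
  by rewrite /h /bump; have := ltn_ord r'; case: leqP => /=; case: leqP => /=; lia.
exists (Ordinal h_lt); move: r'q; rewrite !inE !values /=.
set a := subvalues p q; rewrite -(order_iso_bump h) map_rcons.
have -> : subvalues (ins p r) [seq lift ord_max i | i <- q] = map (bump r) a.
  by rewrite /subvalues -!map_comp; apply: eq_map => i; rewrite /= ins_lift.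
congr (order_iso (rcons _ _) _); rewrite -!map_comp; apply: eq_map => j /=.
by rewrite /h /bump; lia.
Qed.

(** The old frontier embeds into the new one with its positions unchanged; this is the monotonicity
    of [st_mult]. *)
Lemma card_frontier_ins k (v : 'S_k) n (p : 'S_n) r :
  #|frontier v p| <= #|frontier v (ins p r)|.
Proof.
pose lq (q : k.-1.-tuple 'I_n) := map_tuple (lift (@ord_max n)) q.
rewrite -(@card_imset _ _ lq); last first.
  by move=> q q' [/(inj_map (@lift_inj _ _)) e]; apply: val_inj.
apply/subset_leq_card/fintype.subsetP => _ /imsetP[q qF ->]; move: qF; rewrite !inE.
move=> /andP[/andP[incq oq] fq]; rewrite /partial_occ /= increasing_lift incq.
by rewrite order_iso_ins oq forbidden_ranks_ins.
Qed.

Lemma ins_inj n (p p' : 'S_n) r r' : ins p r = ins p' r' -> p = p' /\ r = r'.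
Proof.
move=> e; have rr' : r = r'.
  by have := congr1 (fun u : 'S_n.+1 => u ord_max) e; rewrite /ins !lift_perm_id.
split=> //; apply/permP => i.
have := congr1 (fun u : 'S_n.+1 => u (lift ord_max i)) e.
by rewrite !ins_lift rr'; apply: lift_inj.
Qed.

(** Delete the last value and close the gap it leaves. *)
Lemma ins_surj n (u : 'S_n.+1) : exists p r, u = ins p r.
Proof.
have /fin_all_exists [f hf] (i : 'I_n) :
    exists j, u (lift ord_max i) = lift (u ord_max) j.
  have : u ord_max != u (lift ord_max i).
    by rewrite (inj_eq perm_inj) neq_lift.
  by move=> /unlift_some[j ej _]; exists j.
have f_inj : injective f.
  by move=> i j e; have := hf i; rewrite e -hf => /perm_inj/lift_inj.
exists (perm f_inj), (u ord_max); apply/permP => i.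
case: (unliftP ord_max i) => [j|] ->; last by rewrite /ins lift_perm_id.
by rewrite ins_lift permE hf.
Qed.

End Insertion.

(** * The insertion system *)

Section States.
Variables (k : nat) (v : 'S_k).
Local Open Scope nat_scope.

(** The frontier component is determined by the permutation, so facts about states reduce to facts
    about avoiding permutations. *)
Lemma stateP (x : state v) : exists n (p : 'S_n) (av : avoids v p), x = mk_state av.
Proof.
case: x => -[n [p F]] h; have /andP[/= av /eqP FE] := h.
by exists n, p, av; apply: val_inj => /=; rewrite FE.
Qed.

Lemma mk_state_inj n (p p' : 'S_n) (av : avoids v p) (av' : avoids v p') :
  mk_state av = mk_state av' -> p = p'.
Proof. by move=> /(congr1 val)/eqP; rewrite eq_Tagged => /eqP[]. Qed.

Lemma eq_mk_state n (p p' : 'S_n) (av : avoids v p) (av' : avoids v p') :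
  p = p' -> mk_state av = mk_state av'.
Proof. by move=> e; subst p'; congr mk_state; apply: bool_irrelevance. Qed.

(** An explicit list without repetitions serves both the finiteness of the levels and the evaluation
    of sums over all states. *)
Definition states n : seq (state v) :=
  [seq mk_state (valP p) | p <- enum {: {p : 'S_n | avoids v p}}].

Lemma mem_states n (x : state v) : (x \in states n) = (st_size x == n).
Proof.
apply/mapP/eqP => [[p _ ->//]|]; have [m [p [av ->]]] := stateP x.
rewrite /st_size /= => e; subst m; exists (exist _ p av); rewrite ?mem_enum//.
exact: eq_mk_state.
Qed.

Lemma states_uniq n : uniq (states n).
Proof.
rewrite map_inj_uniq ?enum_uniq// => p q /mk_state_inj; exact: val_inj.
Qed.

Lemma size_states n : size (states n) = #|Av v n|.
Proof.
rewrite size_map -cardE card_sig; apply: eq_card => p.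
by rewrite /Av finset.in_set.
Qed.

Lemma finite_states L : finite_set [set x : state v | st_size x <= L].
Proof.
apply: (@sub_finite_set _ _ (\bigcup_(n in `I_L.+1) [set` states n])).
  by move=> x xL; exists (st_size x) => //=; rewrite mem_states.
by apply: bigcup_finite => // n _; apply: finite_seq.
Qed.

Lemma st_mult_mk n (p : 'S_n) (av : avoids v p) :
  st_mult (mk_state av) = #|frontier v p|.
Proof. by []. Qed.

Lemma st_mult_next (x : state v) (r : st_act x) : st_mult x <= st_mult (st_next r).
Proof.
move: r; have [n [p [av ->]]] := stateP x => r.
by rewrite !st_mult_mk; apply: card_frontier_ins.
Qed.

Lemma card_st_act (x : state v) : #|{: st_act x}| <= (st_size x).+1.
Proof. by rewrite card_sig -[leqRHS]card_ord; apply: max_card. Qed.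

(** The size of the target fixes that of the source, so both sides insert into permutations of one
    length and [ins_inj] applies. *)
Lemma st_next_inj (e e' : {x : state v & st_act x}) :
  st_next (tagged e) = st_next (tagged e') -> e = e'.
Proof.
case: e e' => [x r] [x' r'] /=; move: r r'.
have [n [p [av ->]]] := stateP x; have [n' [p' [av' ->]]] := stateP x'.
move=> r r' e; have /eqP en := congr1 (@st_size _ _) e.
rewrite eqSS in en; move/eqP: en; rewrite /st_size /= => en; subst n'.
have [ep er] := ins_inj (mk_state_inj e).
have {ep} ep : p = p' by exact: ep.
(* Only after the two avoidance proofs are identified do both ranks have the same type. *)
subst p'; rewrite (bool_irrelevance av' av) in r' er e *.
by congr existT; apply: val_inj.
Qed.

(** Both conditions on the predecessor follow by contraposition: an occurrence in [p], or a
    forbidden [r], would produce an occurrence in [ins p r]. *)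
Lemma st_next_surj (y : state v) m : 0 < k -> st_size y = m.+1 ->
  exists2 e : {x : state v & st_act x}, st_next (tagged e) = y & st_size (tag e) = m.
Proof.
move=> k0; have [n [u [av ->]]] := stateP y; rewrite /st_size /= => e; subst n.
have [p [r upr]] := ins_surj u; subst u.
have avp : avoids v p by apply: contra av; apply: contains_ins.
have rF : r \in admissible (mk_state avp).
  by rewrite finset.in_setC; apply: contra av; apply: contains_ins_Forb.
exists (existT _ (mk_state avp) (exist _ r rF)) => //.
exact: eq_mk_state.
Qed.

End States.

Section InsertionSystemTheory.
Variables (R : realType) (k : nat) (v : 'S_k) (hk : (1 < k)%N).
Let X := insertion_system v hk.

Lemma insertion_system_right_visible : right_visible R X.
Proof.
split.
- apply: (@sub_countable _ nat _ setT); last exact: countableP.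
  apply/pcard_leTP/injPex; exists (fun x : state v => pickle (val x : prestate k)) => //.
  by move=> x y _ _ /(pcan_inj pickleK)/val_inj.
- exact: finite_states.
- by [].
- exact: st_mult_next.
- exists 1, 1; split=> // x.
  by rewrite mul1r addrC natr1 ler_nat card_st_act.
Qed.

(** A state of size [n + 1] has exactly one incoming edge, from a state of size [n], so its mass is
    copied from that single predecessor. *)
Lemma iter_transfer_dual n (y : gs_state X) :
  iter n (@transfer_dual R X) (@dirac_root R X) y = (gs_size y == n)%:R.
Proof.
elim: n y => [|n IH] y; rewrite /= /dirac_root.
  congr ((nat_of_bool _)%:R); apply/eqP/eqP => [->//|].
  have [m [p [av ->]]] := stateP y; rewrite /st_size /= => e; subst m.
  by apply: eq_mk_state; apply/permP => -[].
rewrite /transfer_dual; have [yn|yn] := eqVneq (gs_size y) n.+1.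
  have [e ey en] := st_next_surj (ltnW hk) yn.
  rewrite (_ : [set _ | _] = [set e]) ?fsbig_set1 ?IH /= ?en ?eqxx//.
  by apply/seteqP; split => [e'|e' ->//] /=; rewrite -ey => /st_next_inj.
(* Here no predecessor of [y] has size [n], so every summand vanishes by induction. *)
rewrite fsbig1// => e /= ey; rewrite IH; apply/eqP; rewrite pnatr_eq0 eqb0.
by move: yn; rewrite -ey /= /st_size /= eqSS.
Qed.

Lemma card_Av_transfer_dual n :
  #|Av v n|%:R = \sum_(y \in [set: gs_state X])
    iter n (@transfer_dual R X) (@dirac_root R X) y.
Proof.
rewrite (fsbigE (states v n)) ?states_uniq//; last first.
  by move=> y _; rewrite mem_states iter_transfer_dual => /negbTE ->.
rewrite -size_states -sum1_size natr_sum [RHS]big_seq_cond.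
rewrite [LHS]big_seq_cond.
apply: eq_big => [y|y /andP[ys _]]; first by rewrite in_setT.
by move: ys; rewrite mem_states iter_transfer_dual => /= ->.
Qed.

End InsertionSystemTheory.

(** * Geometric series and Neumann inversion *)

Section GeometricLimits.
Variable R : realType.

(** Multiplying by [1 - q] makes the sum telescope. The field is arbitrary because both [R] and
    [R[i]] occur below. *)
Lemma geometric_sum_le (K : numFieldType) (q : K) N M : 0 <= q -> q < 1 ->
  \sum_(N <= i < M) q ^+ i <= q ^+ N / (1 - q).
Proof.
move=> q0 q1; have q1' : 0 < 1 - q by rewrite subr_gt0.
rewrite ler_pdivlMr//; have [NM|MN] := leqP N M; last first.
  by rewrite big_geq ?mul0r ?exprn_ge0// ltnW.
rewrite mulr_suml (@telescope_sumr_eq _ _ _ (fun i => - q ^+ i))//.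
  by rewrite opprK addrC lerBlDr lerDl exprn_ge0.
by move=> i _; rewrite exprS; ring.
Qed.

(** Completeness of [R] with an explicit rate: the bound between partial sums passes to the
    limit. *)
Lemma real_geometric_limit (a : nat -> R) (C q : R) : 0 <= q -> q < 1 ->
    (forall n, `|a n| <= C * q ^+ n) ->
  exists l, forall N, `|l - \sum_(i < N) a i| <= C * q ^+ N / (1 - q).
Proof.
move=> q0 q1 aq; have C0 : 0 <= C.
  by have := aq 0; rewrite expr0 mulr1; apply: le_trans.
have tail N M : (N <= M)%N ->
    `|\sum_(i < M) a i - \sum_(i < N) a i| <= C * q ^+ N / (1 - q).
  move=> NM; rewrite -!(big_mkord xpredT) (big_cat_nat (leq0n N) NM)/= addrAC subrr add0r.
  apply: le_trans (ler_norm_sum _ _ _) _.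
  apply: (@le_trans _ _ (\sum_(N <= i < M) C * q ^+ i)); first exact: ler_sum.
  by rewrite -mulr_sumr -mulrA ler_wpM2l// geometric_sum_le.
have cv : cvgn (series a).
  apply: normed_cvg; apply: (@series_le_cvg _ _ (geometric C q)) => //.
  - by move=> n; apply: normr_ge0.
  - by move=> n; rewrite /geometric /= mulr_ge0 ?exprn_ge0.
  - by apply: is_cvg_geometric_series; rewrite ger0_norm.
exists (limn (series a)) => N.
have cvN : (fun M => `|series a M - \sum_(i < N) a i|) @ \oo -->
    `|limn (series a) - \sum_(i < N) a i|.
  by apply: cvg_norm; apply: cvgB => //; exact: cvg_cst.
rewrite -(cvg_lim _ cvN)//; apply: limr_le; first exact: cvgP cvN.
by exists N => // M /= NM; rewrite /series /= big_mkord tail.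
Qed.

(** Nonnegative elements of [R[i]] are real, which lets bounds stated in [R[i]] be proved in [R]. *)
Lemma complex_real_eq (x : R[i]) : 0 <= x -> x = (complex.Re x)%:C%C.
Proof. by move=> /ger0_real x0; rewrite RRe_real. Qed.

Lemma normC_ReIm (x : R[i]) : `|x| <= (`|complex.Re x| + `|complex.Im x|)%:C%C.
Proof.
rewrite normc_def lecR -(ger0_norm (addr_ge0 (normr_ge0 (complex.Re x))
  (normr_ge0 (complex.Im x)))) -sqrtr_sqr ler_wsqrtr//.
rewrite -[leLHS]/(complex.Re x ^+ 2 + complex.Im x ^+ 2).
rewrite -(real_normK (num_real (complex.Re x))) -(real_normK (num_real (complex.Im x))).
rewrite sqrrD lerD2r.
by rewrite lerDl mulrn_wge0 ?mulr_ge0.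
Qed.

Lemma normC_ge_Im (x : R[i]) : (`|complex.Im x|)%:C%C <= `|x|.
Proof. by rewrite normc_def lecR -sqrtr_sqr ler_wsqrtr// lerDr sqr_ge0. Qed.

(** Real and imaginary parts converge separately; adding their errors costs the factor 2. *)
Lemma complex_geometric_limit (a : nat -> R[i]) (C q : R[i]) : 0 <= q -> q < 1 ->
    (forall n, `|a n| <= C * q ^+ n) ->
  exists l, forall N, `|l - \sum_(i < N) a i| <= 2 * C * q ^+ N / (1 - q).
Proof.
move=> q0 q1 aq; have C0 : 0 <= C.
  by have := aq 0%N; rewrite expr0 mulr1; apply: le_trans.
move: q0 q1 aq; rewrite (complex_real_eq C0).
case: q => q qi /=; rewrite lecE ltcE /= => /andP[/eqP -> q0] /andP[_ q1].
rewrite -/(q%:C%C) => aq.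
have part (f : R[i] -> R) : (forall x y, f (x - y) = f x - f y) ->
    (forall x, (`|f x|)%:C%C <= `|x|) ->
    exists l, forall N,
      `|l - \sum_(i < N) f (a i)| <= complex.Re C * q ^+ N / (1 - q).
  move=> fB fle; apply: (@real_geometric_limit (f \o a)) => // n.
  by rewrite -lecR rmorphM rmorphXn; exact: le_trans (fle _) (aq n).
have [l1 h1] := part (@complex.Re R) (fun x y => raddfB _ x y) (@normc_ge_Re R).
have [l2 h2] := part (@complex.Im R) (fun x y => raddfB _ x y) (normC_ge_Im).
exists (Complex l1 l2) => N; apply: le_trans (normC_ReIm _) _.
have -> : complex.Re (Complex l1 l2 - \sum_(i < N) a i) =
    l1 - \sum_(i < N) complex.Re (a i) by rewrite raddfB /= raddf_sum.
have -> : complex.Im (Complex l1 l2 - \sum_(i < N) a i) =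
    l2 - \sum_(i < N) complex.Im (a i) by rewrite raddfB /= raddf_sum.
have -> : 2 * (complex.Re C)%:C%C * q%:C%C ^+ N / (1 - q%:C%C) =
    (2 * complex.Re C * q ^+ N / (1 - q))%:C%C.
  by rewrite !(rmorphM, rmorphXn, fmorphV, rmorphB, rmorph_nat, rmorph1).
rewrite lecR; apply: le_trans (lerD (h1 N) (h2 N)) _.
by rewrite -!mulrA mulr2n mulrDl !mul1r.
Qed.

(** Turns a family of geometric error bounds into an exact identity. *)
Lemma geometric_le0 (x C q : R[i]) : 0 <= x -> 0 <= q -> q < 1 ->
  (forall N, x <= C * q ^+ N) -> x = 0.
Proof.
move=> x0 q0 q1 xq; have C0 : 0 <= C.
  by have := le_trans x0 (xq 0%N); rewrite expr0 mulr1.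
move: x0 q0 q1 xq; rewrite (complex_real_eq C0); set c := complex.Re C.
case: x => x xi; case: q => q qi /=.
rewrite !lecE ltcE /= => /andP[/eqP -> x0] /andP[/eqP -> q0] /andP[_ q1] xq.
have cv : (fun N => c * q ^+ N) @ \oo --> (0 : R).
  by apply: cvg_geometric; rewrite ger0_norm.
congr (_%:C%C); apply/eqP; rewrite eq_le x0 andbT -(cvg_lim _ cv)//.
apply: limr_ge; first exact: cvgP cv.
by near=> N; rewrite -lecR rmorphM rmorphXn; exact: xq.
Unshelve. all: by end_near. Qed.

End GeometricLimits.

(** * Completeness of the weighted space along geometric series *)

Section WspaceComplete.
Variables (R : realType) (G : growth_system) (theta kappa : {posnum R}).
Local Notation E := (wspace G theta kappa).

Definition weight (x : gs_state G) : R[i] :=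
  (theta%:num ^- gs_mult x * kappa%:num ^- (gs_size x ^ 2))%:C%C.

Lemma weight_gt0 x : 0 < weight x.
Proof. by rewrite /weight ltcR mulr_gt0 ?invr_gt0 ?exprn_gt0. Qed.

Lemma wabsC (f : gs_state G -> R[i]) x :
  (wabs theta kappa f x)%:C%C = weight x * `|f x|.
Proof. by rewrite /wabs rmorphM. Qed.

Lemma weight_norm_le (f : E) x : weight x * `|f x| <= `|f|.
Proof. by rewrite -wabsC lecR wnorm_ub. Qed.

Lemma wspace_norm_le (f : E) (M : R[i]) :
  (forall x, weight x * `|f x| <= M) -> `|f| <= M.
Proof.
move=> h; have M0 : 0 <= M.
  by apply: le_trans (h (gs_root G)); rewrite mulr_ge0 ?(ltW (weight_gt0 _)).
rewrite (complex_real_eq M0) lecR; apply: wnorm_le => x.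
by rewrite -lecR wabsC -(complex_real_eq M0).
Qed.

Lemma wbounded_le (f : gs_state G -> R[i]^o) (M : R[i]) :
  (forall x, weight x * `|f x| <= M) -> f \in wbounded theta kappa.
Proof.
move=> h; have M0 : 0 <= M.
  by apply: le_trans (h (gs_root G)); rewrite mulr_ge0 ?(ltW (weight_gt0 _)).
apply/asboolP; exists (complex.Re M) => _ [x _ <-].
by rewrite -lecR wabsC -(complex_real_eq M0).
Qed.

Lemma wspace_sumE (a : nat -> E) N x : (\sum_(i < N) a i : E) x = \sum_(i < N) a i x.
Proof. by elim/big_ind2: _ => // f u g w <- <-. Qed.

(** The series converges at each state with an error proportional to [1 / weight x]. Multiplication
    by the weight makes the error uniform, so the pointwise limit lies in the space and is a limit
    in norm. *)
Lemma wspace_geometric_limit (a : nat -> E) (C q : R[i]) : 0 <= q -> q < 1 ->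
    (forall n, `|a n| <= C * q ^+ n) ->
  exists l : E, forall N, `|l - \sum_(i < N) a i| <= 2 * C * q ^+ N / (1 - q).
Proof.
move=> q0 q1 aq.
have /boolp.choice[l hl] x : exists l, forall N,
    `|l - \sum_(i < N) a i x| <= 2 * (C / weight x) * q ^+ N / (1 - q).
  apply: (@complex_geometric_limit R (fun n => a n x)) => // n.
  rewrite mulrAC ler_pdivlMr ?weight_gt0// mulrC.
  exact: le_trans (weight_norm_le _ _) (aq n).
have {}hl x N : weight x * `|l x - \sum_(i < N) a i x| <= 2 * C * q ^+ N / (1 - q).
  have w0 := weight_gt0 x.
  apply: le_trans (ler_wpM2l (ltW w0) (hl x N)) _.
  have wN0 : weight x != 0 by rewrite gt_eqF.
  have qN0 : 1 - q != 0 by rewrite subr_eq0 gt_eqF.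
  move: (weight x) wN0 => w wN0; rewrite le_eqVlt; apply/orP; left; apply/eqP.
  by field; rewrite wN0 qN0.
have lb : (l : gs_state G -> R[i]^o) \in wbounded theta kappa.
  by apply: (@wbounded_le _ (2 * C * q ^+ 0 / (1 - q))) => x;
     have := hl x 0; rewrite big_ord0 subr0.
exists (WSpace lb) => N; apply: wspace_norm_le => x.
have -> : (WSpace lb - \sum_(i < N) a i : E) x = l x - (\sum_(i < N) a i : E) x.
  by [].
by rewrite wspace_sumE.
Qed.

End WspaceComplete.

(** * Inverting [T - l] when [|l|] exceeds a norm bound for [T] *)

Section Neumann.
Variables (R : realType) (G : growth_system) (theta kappa : {posnum R}).
Local Notation E := (wspace G theta kappa).
Variables (T : {linear E -> E}) (q : R[i]).
Hypotheses (q0 : 0 <= q) (Tq : forall f, `|T f| <= q * `|f|).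

Lemma norm_iter_le n f : `|iter n T f| <= q ^+ n * `|f|.
Proof.
elim: n => [|n IH]; first by rewrite expr0 mul1r.
by rewrite iterS exprS -mulrA (le_trans (Tq _))// ler_wpM2l.
Qed.

Lemma resolvent_inj (l : R[i]) f : q < `|l| -> T f - l *: f = 0 -> f = 0.
Proof.
move=> ql /eqP; rewrite subr_eq0 => /eqP Tf; apply/eqP; rewrite -normr_eq0.
apply: contraT => f0; have {}f0 : 0 < `|f| by rewrite lt_def f0 normr_ge0.
have := Tq f; rewrite Tf normrZ ler_pM2r//.
by move=> /(lt_le_trans ql); rewrite ltxx.
Qed.

(** The solution is the Neumann series [- sum_n l^-(n+1) T^n g], whose terms decay like [r ^ n] with
    [r = q / |l| < 1]. *)
Lemma resolvent_surj (l : R[i]) g : q < `|l| -> exists f, T f - l *: f = g.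
Proof.
move=> ql; have l0 : 0 < `|l| by exact: le_lt_trans ql.
have lN0 : l != 0 by rewrite -normr_gt0.
pose r := q / `|l|.
have r0 : 0 <= r by rewrite divr_ge0.
have r1 : r < 1 by rewrite ltr_pdivrMr// mul1r.
pose a n : E := - (l ^- n.+1 *: iter n T g).
have [n|f hf] := @wspace_geometric_limit _ _ _ _ a (`|g| / `|l|) r r0 r1.
  rewrite normrN normrZ normfV normrX /r expr_div_n exprS invfM.
  apply: le_trans (ler_wpM2l _ (norm_iter_le n g)) _.
    by rewrite mulr_ge0 ?invr_ge0 ?exprn_ge0.
  by rewrite le_eqVlt; apply/orP; left; apply/eqP; ring.
have tele N : T (\sum_(i < N) a i) - l *: (\sum_(i < N) a i) =
    g - l ^- N *: iter N T g.
  elim: N => [|N IH].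
    by rewrite big_ord0 linear0 scaler0 subrr expr0 invr1 scale1r subrr.
  rewrite big_ord_recr /= linearD scalerDr opprD addrACA IH /a.
  rewrite linearN scalerN opprK [T (_ *: _)]linearZ scalerA /=.
  have -> : l * l ^- N.+1 = l ^- N by rewrite exprS invfM mulrA divff ?mul1r.
  by rewrite addrCA subrK addrC.
exists f; apply/eqP; rewrite -subr_eq0 -normr_eq0; apply/eqP.
(* The first summand bounds [T - l] applied to the tail [f - S], with operator norm at most
   [q + |l|]; the second bounds the remainder [l^-N T^N g] of the telescoping sum. *)
pose D := (q + `|l|) * (2 * (`|g| / `|l|) / (1 - r)) + `|g|.
apply: (@geometric_le0 _ _ D r) => // N.
set S := \sum_(i < N) a i.
have -> : T f - l *: f - g = T (f - S) - l *: (f - S) - l ^- N *: iter N T g.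
  have -> : T (f - S) - l *: (f - S) = (T f - l *: f) - (T S - l *: S).
    by rewrite linearB scalerBr opprD addrACA -opprD.
  by rewrite tele opprB addrA [RHS]addrAC addrK.
apply: le_trans (ler_normB _ _) _.
rewrite mulrDl lerD//; last first.
  rewrite normrZ normfV normrX /r expr_div_n.
  apply: le_trans (ler_wpM2l _ (norm_iter_le N g)) _; first by rewrite invr_ge0 exprn_ge0.
  by rewrite le_eqVlt; apply/orP; left; apply/eqP; ring.
apply: le_trans (ler_normB _ _) _; rewrite normrZ -mulrA mulrDl.
have hS : `|f - S| <= 2 * (`|g| / `|l|) / (1 - r) * r ^+ N by rewrite mulrAC hf.
by rewrite lerD ?(le_trans (Tq _)) ?ler_wpM2l.
Qed.

(** [T - l] is bijective, so kernel and cokernel are spanned by empty families and the range is the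
    whole space. *)
Lemma resolvent_fredholm (l : R[i]) : q < `|l| -> fredholm (fun f => T f - l *: f).
Proof.
move=> ql; split.
- exists 0, (fun _ => 0) => f /(resolvent_inj ql) ->.
  by exists (fun _ => 0); rewrite big_ord0.
- suff -> : range (fun f : E => T f - l *: f) = setT by exact: closedT.
  by apply/seteqP; split=> // g _; have [f <-] := resolvent_surj g ql; exists f.
- exists 0, (fun _ => 0) => g; have [f <-] := resolvent_surj g ql.
  by exists f, (fun _ => 0); rewrite big_ord0 addr0.
Qed.

End Neumann.

(** * Norm and essential spectrum of the transfer operator *)

Section Transfer.
Variables (R : realType) (G : growth_system) (theta kappa : {posnum R}) (q : R).
Local Notation E := (wspace G theta kappa).
Hypotheses (theta1 : theta%:num <= 1)
  (next_size : forall (x : gs_state G) (r : gs_act x),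
     gs_size (gs_next r) = (gs_size x).+1)
  (next_mult : forall (x : gs_state G) (r : gs_act x),
     (gs_mult x <= gs_mult (gs_next r))%N)
  (act_le : forall x : gs_state G,
     #|{: gs_act x}|%:R * kappa%:num ^+ (2 * gs_size x).+1 <= q).

(** The gain is [(s + 1)^2 - s^2 = 2 s + 1] powers of [kappa]; the [theta] factor can only help
    since [gs_mult] does not decrease and [theta <= 1]. *)
Lemma weight_next (x : gs_state G) (r : gs_act x) :
  weight theta kappa x <=
  (kappa%:num ^+ (2 * gs_size x).+1)%:C%C * weight theta kappa (gs_next r).
Proof.
rewrite /weight -rmorphM lecR next_size mulrCA.
have -> : kappa%:num ^+ (2 * gs_size x).+1 * kappa%:num ^- ((gs_size x).+1 ^ 2) =
    kappa%:num ^- (gs_size x ^ 2).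
  rewrite (_ : (gs_size x).+1 ^ 2 = (2 * gs_size x).+1 + gs_size x ^ 2)%N; last by nia.
  by rewrite exprD invfM mulrA divff ?mul1r// expf_neq0// gt_eqF.
rewrite ler_wpM2r ?invr_ge0 ?exprn_ge0// lef_pV2 ?posrE ?exprn_gt0//.
exact: ler_wiXn2l.
Qed.

Lemma transfer_weight_le (z : R[i]) (f : E) x : `|z| <= 1 ->
  weight theta kappa x * `|transfer z f x| <= q%:C%C * `|f|.
Proof.
move=> z1; have w0 := ltW (weight_gt0 theta kappa x).
apply: le_trans (ler_wpM2l w0 (ler_norm_sum _ _ _)) _; rewrite mulr_sumr.
apply: (@le_trans _ _ (\sum_(r : gs_act x)
    (kappa%:num ^+ (2 * gs_size x).+1)%:C%C * `|f|)).
  apply: ler_sum => r _; rewrite normrM.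
  apply: (@le_trans _ _ (weight theta kappa x * `|f (gs_next r)|)).
    by rewrite ler_wpM2l// ler_piMl.
  apply: le_trans (ler_wpM2r (normr_ge0 _) (weight_next r)) _.
  by rewrite -mulrA ler_wpM2l ?weight_norm_le// lecR exprn_ge0.
rewrite sumr_const -mulr_natl mulrA ler_wpM2r//.
by rewrite -(rmorph_nat (@real_complex R)) -rmorphM lecR.
Qed.

Definition transfer_op (z : R[i]) (z1 : `|z| <= 1) (f : E) : E :=
  WSpace (wbounded_le (fun x => transfer_weight_le f x z1)).

Lemma transfer_op_linear z z1 : linear (@transfer_op z z1).
Proof.
move=> c f g; apply/val_inj/funext => x.
have -> : \val (c *: transfer_op z1 f + transfer_op z1 g) x =
    c * transfer z f x + transfer z g x by [].
rewrite /= /transfer mulr_sumr -big_split /=; apply: eq_bigr => r _.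
by rewrite [c * _]mulrCA -mulrDr.
Qed.

HB.instance Definition _ z z1 :=
  GRing.isLinear.Build R[i] E E _ (@transfer_op z z1) (@transfer_op_linear z z1).

Lemma transfer_op_bound z z1 f : `|@transfer_op z z1 f| <= q%:C%C * `|f|.
Proof. by apply: wspace_norm_le => x; apply: transfer_weight_le. Qed.

Lemma transfer_op_quasi_compact z z1 : q < 1 -> quasi_compact (@transfer_op z z1).
Proof.
move=> q1; apply: le_lt_trans (_ : q%:E < 1)%E; last by rewrite lte_fin.
apply: ge_ereal_sup => _ [l hl <-]; rewrite lee_fin leNgt; apply/negP => ql.
have q0 : 0 <= q%:C%C :> R[i].
  rewrite lecR; apply: le_trans (act_le (gs_root G)).
  by rewrite mulr_ge0 ?exprn_ge0.
by apply: hl; apply: (resolvent_fredholm q0 (transfer_op_bound z1)); rewrite ltcR.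
Qed.

End Transfer.

Lemma right_visible_transfer (R : realType) (G : growth_system) :
  right_visible R G ->
  exists theta kappa : {posnum R}, [/\ theta%:num < 1, kappa%:num < 1
    & forall z : R[i], `|z| <= 1 ->
        exists T : {linear wspace G theta kappa -> wspace G theta kappa},
          [/\ forall f x, T f x = transfer z f x,
              bounded_operator T & quasi_compact T]].
Proof.
move=> [_ _ next_size next_mult [C0 [C1 [C0_ge0 C1_ge0 act_le]]]].
(* [B] satisfies [C0 + C1 s <= B (s + 1)], and [B >= 1] makes [kappa = 1 / (2 B)] at most [1/2]. *)
pose B := C0 + C1 + 1; have B1 : 1 <= B by rewrite /B; lra.
have kappa_gt0 : 0 < (2 * B)^-1 by rewrite invr_gt0; lra.
have half_gt0 : 0 < 2^-1 :> R by [].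
pose kappa := PosNum kappa_gt0; pose theta := PosNum half_gt0.
have Bk : B * kappa%:num = 2^-1 by rewrite /=; field; lra.
have k2 : kappa%:num <= 2^-1 by rewrite /= lef_pV2 ?posrE; lra.
have theta1 : theta%:num < 1 by rewrite /=; lra.
have act_le_half (x : gs_state G) :
    #|{: gs_act x}|%:R * kappa%:num ^+ (2 * gs_size x).+1 <= 2^-1.
  set s := gs_size x; have k0 : 0 <= kappa%:num by [].
  (* From [s + 1 <= 2 ^ s] and [kappa <= 1/2]. The bound then splits as
     [(B kappa) ((s + 1) kappa^s) kappa^s], with first factor [1/2] and the others at most 1. *)
  have sk : s.+1%:R * kappa%:num ^+ s <= 1.
    apply: (@le_trans _ _ (2 ^+ s * 2^-1 ^+ s)); last by rewrite -exprMn divff ?expr1n.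
    apply: ler_pM; rewrite ?exprn_ge0//; last by rewrite lerXn2r ?nnegrE//; lra.
    by rewrite -natrX ler_nat ltn_expl.
  have sB : C0 + C1 * s%:R <= B * s.+1%:R.
    by rewrite -natr1 /B; have := ler0n R s; nra.
  have ks : kappa%:num ^+ s <= 1 by rewrite exprn_ile1//; lra.
  have ks0 : 0 <= kappa%:num ^+ s by rewrite exprn_ge0.
  apply: (@le_trans _ _ (B * s.+1%:R * kappa%:num ^+ (2 * s).+1)).
    by rewrite ler_wpM2r ?exprn_ge0// (le_trans (act_le x)).
  rewrite exprS mul2n -addnn exprD.
  have -> : B * s.+1%:R * (kappa%:num * (kappa%:num ^+ s * kappa%:num ^+ s)) =
     2^-1 * (s.+1%:R * kappa%:num ^+ s * kappa%:num ^+ s) by rewrite -Bk; ring.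
  rewrite ler_piMr// mulr_ile1// mulr_ge0//.
exists theta, kappa; split=> //; first by lra.
move=> z z1; exists (transfer_op (ltW theta1) next_size next_mult act_le_half z1).
split=> //.
  by exists (2^-1)%:C%C => f; apply: transfer_op_bound.
by apply: transfer_op_quasi_compact; lra.
Qed.

(** * Power series *)

Section PowerSeries.
Variable R : realType.
Let K : numFieldType := R[i].

Lemma cvg_geometric_dist (u : nat -> K) (l C q : K) : 0 <= q -> q < 1 ->
  (forall n, `|l - u n| <= C * q ^+ n) -> u n @[n --> \oo] --> l.
Proof.
move=> q0 q1 uq; apply/cvgrPdist_lt => e e0.
have C0 : 0 <= C by have := uq 0%N; rewrite expr0 mulr1; apply: le_trans.
move: q0 q1 uq e0; rewrite (complex_real_eq C0); set c := complex.Re C.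
case: q => q qi; case: e => e ei /=.
rewrite lecE !ltcE /= => /andP[/eqP -> q0] /andP[_ q1] uq /andP[/eqP -> e0].
have cv : (fun N => c * q ^+ N) @ \oo --> (0 : R).
  by apply: cvg_geometric; rewrite ger0_norm.
move/cvgrPdist_lt: cv => /(_ e e0)[N _ hN].
exists N => // n /= Nn; apply: le_lt_trans (uq n) _.
rewrite -[Complex q 0]/(q%:C%C) -rmorphXn -rmorphM ltcR.
by have := hN n Nn; rewrite /= sub0r normrN; apply: le_lt_trans; apply: ler_norm.
Qed.


Lemma half_ge0 : 0 <= 2^-1 :> K. Proof. by rewrite invr_ge0. Qed.

Lemma half_lt1 : 2^-1 < 1 :> K. Proof. by rewrite invf_lt1 ?ltr1n. Qed.

Lemma double_half : 1 - 2^-1 = 2^-1 :> K. Proof. by field. Qed.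

Lemma half_geometric_limit (a : nat -> K) (C : K) :
    (forall n, `|a n| <= C * 2^-1 ^+ n) ->
  exists l, forall N, `|l - \sum_(i < N) a i| <= 4 * C * 2^-1 ^+ N.
Proof.
move=> /(complex_geometric_limit half_ge0 half_lt1)[l hl]; exists l => N.
apply: le_trans (hl N) _; rewrite double_half invrK le_eqVlt; apply/orP; left.
by apply/eqP; ring.
Qed.

Section Analytic.
Variables (c : nat -> K) (B : K).
Hypotheses (B0 : 0 < B) (cB : forall n, `|c n| <= B ^+ n).

Lemma power_series_limit (z : K) : `|z| <= (2 * B)^-1 ->
  exists l, forall N, `|l - \sum_(i < N) c i * z ^+ i| <= 4 * 2^-1 ^+ N.
Proof.
move=> zB; have [|l hl] := @half_geometric_limit (fun i => c i * z ^+ i) 1.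
  move=> n; rewrite mul1r normrM normrX.
  have -> : 2^-1 ^+ n = B ^+ n * (2 * B)^-1 ^+ n :> K.
    by rewrite -exprMn invfM mulrCA divff ?mulr1// gt_eqF.
  by rewrite ler_pM ?exprn_ge0// lerXn2r ?nnegrE// invr_ge0 mulr_ge0// ltW.
by exists l => N; rewrite (le_trans (hl N))// mulr1.
Qed.

Lemma cvg_power_series (z l : K) :
  (forall N, `|l - \sum_(i < N) c i * z ^+ i| <= 4 * 2^-1 ^+ N) ->
  power_series c z n @[n --> \oo] --> l.
Proof.
move=> hl; apply: (cvg_geometric_dist half_ge0 half_lt1 (C := 4)) => n.
by rewrite /power_series /series /= big_mkord.
Qed.

(** The limit [b] is the coefficient of [h ^ j] in the expansion around [z]. Since
    ['C(j + m, j) <= 2 ^ (j + m)], the term of index [m] is at most [(2 B)^j 2^-m] when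
    [|z| <= 1 / (4 B)]. *)
Lemma taylor_coef_limit (z : K) j : `|z| <= (4 * B)^-1 ->
  exists b, forall M,
    `|b - \sum_(m < M) c (j + m)%N * z ^+ m *+ 'C(j + m, j)| <=
    4 * (2 * B) ^+ j * 2^-1 ^+ M.
Proof.
move=> zB; apply: (@half_geometric_limit (fun m => c (j + m)%N * z ^+ m *+ 'C(j + m, j))).
move=> m; rewrite normrMn normrM normrX -[leLHS]mulr_natr.
have -> : (2 * B) ^+ j * 2^-1 ^+ m = B ^+ (j + m) * (4 * B)^-1 ^+ m * 2 ^+ (j + m) :> K.
  have BN0 : B != 0 by rewrite gt_eqF.
  rewrite !exprD !exprMn !exprVn (_ : 4 = 2 * 2) ?exprMn; last by ring.
  by field; rewrite ?expf_neq0 ?pnatr_eq0.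
apply: ler_pM; rewrite ?mulr_ge0 ?exprn_ge0//.
  by rewrite ler_pM ?exprn_ge0// lerXn2r ?nnegrE// invr_ge0 mulr_ge0// ltW.
rewrite -natrX ler_nat -[(2 ^ _)%N]/((1 + 1) ^ (j + m))%N expnDn.
rewrite (bigD1 (inord j)) //= inordK ?ltnS ?leq_addr// !exp1n !muln1.
exact: leq_addr.
Qed.

(** Binomial theorem and exchange of finite sums. The cut-off [M - j] records the triangle
    [j + m < M]. *)
Lemma power_series_rearrange (z h : K) M :
  \sum_(n < M) c n * (z + h) ^+ n =
  \sum_(j < M)
    (\sum_(m < M - j) c (j + m)%N * z ^+ m *+ 'C(j + m, j)) * h ^+ j.
Proof.
transitivity (\sum_(n < M) \sum_(j < M) c n * (z ^+ (n - j) * h ^+ j *+ 'C(n, j))).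
  apply: eq_bigr => n _; rewrite exprDn mulr_sumr.
  rewrite (big_ord_widen M (fun j => c n * (z ^+ (n - j) * h ^+ j *+ 'C(n, j)))) //.
  rewrite big_mkcond; apply: eq_bigr => j _; case: ltnP => // nj.
  by rewrite bin_small // mulr0n mulr0.
rewrite exchange_big; apply: eq_bigr => j _; rewrite mulr_suml /=.
rewrite -(big_mkord xpredT (fun n => c n * (z ^+ (n - j) * h ^+ j *+ 'C(n, j)))).
rewrite (big_cat_nat (leq0n j) (ltnW (ltn_ord j))) /= big_nat big1 ?add0r; last first.
  by move=> n /andP[_ nj]; rewrite bin_small // mulr0n mulr0.
rewrite -{1}[nat_of_ord j]add0n big_addn big_mkord; apply: eq_bigr => m _.
by rewrite addnK [(m + j)%N]addnC mulrnAr mulrnAl mulrA.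
Qed.

(** Points [z] with [|z - z0| <= 1 / (4 B)] stay in the disc of radius [1 / (2 B)], where the error
    bound for [F] is available. *)
Lemma power_series_analytic_at (F : K -> K) (z0 : K) :
    (forall z N, `|z| <= (2 * B)^-1 ->
      `|F z - \sum_(i < N) c i * z ^+ i| <= 4 * 2^-1 ^+ N) ->
  `|z0| < (4 * B)^-1 -> analytic_at F z0.
Proof.
move=> hF z0B; have /boolp.choice[b hb] j := taylor_coef_limit j (ltW z0B).
have B4 : 0 < (4 * B)^-1 by rewrite invr_gt0 mulr_gt0.
exists b; near=> z.
have hB : `|z - z0| <= (4 * B)^-1.
  apply: ltW; rewrite distrC; near: z.
  by apply/nbhs_ballP; exists (4 * B)^-1 => //= z; rewrite -ball_normE.
set h := z - z0 in hB *; have zE : z = z0 + h by rewrite /h addrC subrK.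
have zB : `|z| <= (2 * B)^-1.
  rewrite zE (le_trans (ler_normD _ _))// (le_trans (lerD (ltW z0B) hB))//.
  by rewrite le_eqVlt; apply/orP; left; apply/eqP; field; rewrite gt_eqF.
(* Compare both sides with the partial sum of [2 N] terms at [z]. *)
apply: (cvg_geometric_dist half_ge0 half_lt1 (C := 24)) => N.
rewrite /power_series /series /= big_mkord.
pose D j := \sum_(m < N + N - j) c (j + m)%N * z0 ^+ m *+ 'C(j + m, j).
have term j : (2 * B) ^+ j * `|h ^+ j| <= 2^-1 ^+ j.
  rewrite normrX -exprMn lerXn2r ?nnegrE ?mulr_ge0 ?(ltW B0) ?half_ge0//.
  apply: le_trans (ler_wpM2l _ hB) _; first by rewrite mulr_ge0// ltW.
  by rewrite le_eqVlt; apply/orP; left; apply/eqP; field; rewrite gt_eqF.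
have -> : F z - \sum_(j < N) b j * h ^+ j =
    (F z - \sum_(n < N + N) c n * z ^+ n) +
    (\sum_(N <= j < N + N) D j * h ^+ j - \sum_(j < N) (b j - D j) * h ^+ j).
  rewrite zE power_series_rearrange -/D -(big_mkord xpredT (fun j => D j * h ^+ j)).
  rewrite (big_cat_nat (leq0n N) (leq_addr N N)) /= big_mkord.
  have -> : \sum_(j < N) (b j - D j) * h ^+ j =
      \sum_(j < N) b j * h ^+ j - \sum_(j < N) D j * h ^+ j.
    by rewrite -sumrB; apply: eq_bigr => j _; rewrite mulrBl.
  by ring.
have p0 n : 0 <= 2^-1 ^+ n :> K by rewrite exprn_ge0 // half_ge0.
(* Three errors, in units of [2^-N]: 4 for truncating [F z], 16 for the terms [N <= j < 2 N], and 4
   for replacing [D j] by [b j] when [j < N]. *)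
rewrite (_ : 24 = 4 + (16 + 4)); last by ring.
rewrite (mulrDl 4) (mulrDl 16); apply: le_trans (ler_normD _ _) _; apply: lerD.
  apply: le_trans (hF _ _ zB) _.
  by rewrite ler_wpM2l // exprD ler_piMr // exprn_ile1 ?half_ge0 ?(ltW half_lt1).
apply: le_trans (ler_normB _ _) _; apply: lerD.
  apply: le_trans (ler_norm_sum _ _ _) _.
  apply: (@le_trans _ _ (\sum_(N <= j < N + N) 8 * 2^-1 ^+ j)).
    apply: ler_sum => j _; rewrite normrM.
    (* The case [M = 0] of [hb] bounds [b j] itself; the distance from [b j] to [D j] obeys the same
       bound. *)
    have Dj : `|D j| <= 8 * (2 * B) ^+ j.
      have := hb j 0%N; rewrite big_ord0 subr0 expr0 mulr1 => b1.
      have b2 : `|b j - D j| <= 4 * (2 * B) ^+ j.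
        apply: le_trans (hb j _) _; rewrite ler_piMr ?exprn_ile1 ?half_ge0 ?(ltW half_lt1)//.
        by rewrite mulr_ge0 ?exprn_ge0 ?mulr_ge0// ltW.
      rewrite -[D j](subKr (b j)) (le_trans (ler_normB _ _))//.
      by rewrite (_ : 8 = 4 + 4) ?(mulrDl 4) ?lerD // -natrD.
    apply: le_trans (ler_wpM2r (normr_ge0 _) Dj) _.
    by rewrite -mulrA ler_wpM2l.
  rewrite -mulr_sumr (_ : 16 = 8 * 2); last by ring.
  rewrite -mulrA ler_wpM2l //.
  apply: le_trans (geometric_sum_le _ _ half_ge0 half_lt1) _.
  by rewrite double_half invrK mulrC.
apply: le_trans (ler_norm_sum _ _ _) _.
(* The truncation error [(2 B)^j 2^-(2N - j)] times [|h|^j <= (4 B)^-j] is at most [2^-(2N)]; the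
   [N] summands are absorbed by [N <= 2 ^ N]. *)
apply: (@le_trans _ _ (\sum_(j < N) 4 * 2^-1 ^+ (N + N))).
  apply: ler_sum => j _; rewrite normrM.
  apply: le_trans (ler_wpM2r (normr_ge0 _) (hb j _)) _.
  have jN : (j <= N + N)%N by rewrite (leq_trans (ltnW (ltn_ord j)))// leq_addr.
  rewrite -!mulrA ler_wpM2l // mulrCA mulrC.
  by apply: le_trans (ler_wpM2r (p0 _) (term j)) _; rewrite -exprD subnKC.
rewrite sumr_const card_ord -[leLHS]mulr_natr -mulrA ler_wpM2l// exprD -mulrA ler_piMr//.
rewrite exprVn mulrC ler_pdivrMr ?exprn_gt0// mul1r -natrX ler_nat.
by rewrite ltnW// ltn_expl.
Unshelve. all: by end_near. Qed.

End Analytic.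

End PowerSeries.

(** * The generating function and the growth rate *)

Lemma Av_gf_analytic (R : realType) k (v : 'S_k) : (0 < k)%N ->
  exists2 Rv : R, 0 < Rv
    & forall z : R[i], `|z| < Rv%:C%C ->
        cvgn (@power_series R[i] (Av_coef R v) z)
        /\ @analytic_at R[i] (@Av_gf R k v) z.
Proof.
move=> /(card_Av v)[K hK].
(* The successor makes [B] positive even when [K = 0]. *)
pose B : R[i] := K.+1%:R; have B0 : 0 < B by rewrite ltr0n.
have cB n : `|Av_coef R v n| <= B ^+ n.
  rewrite normr_nat -natrX ler_nat (leq_trans (hK n))//.
  by case: n => // n; rewrite leq_exp2r.
have hcvg z : `|z| <= (2 * B)^-1 -> exists2 l,
    power_series (Av_coef R v) z n @[n --> \oo] --> (l : (R[i] : numFieldType))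
    & forall N, `|l - \sum_(i < N) Av_coef R v i * z ^+ i| <= 4 * 2^-1 ^+ N.
  move=> /(power_series_limit B0 cB)[l hl]; exists l => //.
  exact: cvg_power_series hl.
exists (4 * K.+1%:R)^-1 => [|z]; first by rewrite invr_gt0 mulr_gt0 ?ltr0n.
have -> : ((4 * K.+1%:R)^-1)%:C%C = (4 * B)^-1 :> R[i].
  by rewrite !(fmorphV, rmorphM, rmorph_nat).
move=> zB; split.
  have [|l hl _] := hcvg z; last exact: (cvgP l hl).
  rewrite (le_trans (ltW zB))// lef_pV2 ?posrE ?mulr_gt0// ler_pM2r//.
  by rewrite ler_nat.
apply: (power_series_analytic_at B0 cB _ zB) => w N /hcvg[l cl hl].
by rewrite /Av_gf (cvg_lim _ cl).
Qed.

(** All terms lie between 0 and [K + 1], so the upper limit does too. *)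
Lemma limn_esup_root_fin_num (R : realType) (u : nat -> nat) K :
  (forall n, (u n <= K ^ n)%N) ->
  limn_esup (fun n => (((u n)%:R : R) `^ (n%:R^-1))%:E) \is a fin_num.
Proof.
move=> uK; set f := fun n => _.
rewrite ge0_fin_numE; last first.
  by apply: limf_esup_ge0 => [|n]; [|rewrite lee_fin powR_ge0].
apply: (@le_lt_trans _ _ (K.+1%:R)%:E); last exact: ltry.
apply: (@le_trans _ _ (ereal_sup (f @` setT))).
  by apply: ereal_inf_lbound; exists setT => //; exact: filterT.
apply: ge_ereal_sup => _ [n _ <-]; rewrite lee_fin.
(* At [n = 0] the exponent [0^-1] is 0 and the term is 1, which [K + 1] still bounds. *)
case: n => [|n]; first by rewrite invr0 powRr0 ler1n.
have uKn : (u n.+1)%:R <= K.+1%:R `^ n.+1%:R :> R.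
  by rewrite powR_mulrn// -natrX ler_nat (leq_trans (uK _))// leq_exp2r.
apply: (le_trans (ge0_ler_powR _ _ _ uKn)); rewrite ?nnegrE ?powR_ge0 ?invr_ge0//.
by rewrite -powRrM divff ?powRr1 ?pnatr_eq0.
Qed.

Theorem corollary4p12 (R : realType) (k : nat) (hk : (1 < k)%N) (v : 'S_k) :
  let X := insertion_system v hk in
  [/\ right_visible R X,
      exists theta kappa : {posnum R},
        [/\ theta%:num < 1, kappa%:num < 1
          & forall z : R[i], `|z| <= 1 ->
              exists T : {linear wspace X theta kappa -> wspace X theta kappa},
                [/\ forall f x, T f x = transfer z f x,
                    bounded_operator T & quasi_compact T]],
      forall n : nat,
        #|Av v n|%:R =
        \sum_(y \in [set: gs_state X])
          iter n (@transfer_dual R X) (@dirac_root R X) y,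
      exists2 Rv : R, 0 < Rv
        & forall z : R[i], `|z| < Rv%:C%C ->
            cvgn (@power_series R[i] (Av_coef R v) z)
            /\ @analytic_at R[i] (@Av_gf R k v) z
    & limn_esup (fun n => ((#|Av v n|%:R : R) `^ (n%:R^-1))%:E)
        \is a fin_num].
Proof.
move=> X; have rv : right_visible R X by exact: insertion_system_right_visible.
split=> //.
- exact: right_visible_transfer.
- exact: card_Av_transfer_dual.
- exact: Av_gf_analytic (ltnW hk).
- by have [K hK] := card_Av v (ltnW hk); exact: (limn_esup_root_fin_num R hK).
Qed.
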